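(* Let $d=1$, let $p:\mathbb{Z}\to[0,1)$ satisfy $\sum_xp(x)=1$, $p(x)=0$ for $|x|>M$ for some $M<\infty$, and have span $1$ in the strong sense that for every $u\in\mathbb{Z}$ the smallest additive subgroup of $\mathbb{Z}$ containing $\{u+x:p(x)>0\}$ is $\mathbb{Z}$; let $\sigma_1^2=\sum_x(x-m_p)^2p(x)>0$ where $m_p=\sum_x xp(x)$. Let $\xi=\{\xi_t(x)\}$ be i.i.d. real with mean zero and variance $\sigma_\xi^2<\infty$. Let $V_0(0,x)=\mathbb{E}[\Delta_0(0)\Delta_0(x)]$. Then there exist constants $0<A,c<\infty$ such that $|V_0(0,x)|\le Ae^{-c|x|}$ for all $x\in\mathbb{Z}$, \[V_0(0,x)=\sigma_\xi^2[a(x-1)+a(x+1)-2a(x)]=\frac{\sigma_\xi^2}{\pi}\int_{-\pi}^{\pi}\frac{1-\cos\theta}{1-\phi_q(\theta)}e^{\iota\theta x}\,d\theta,\quad x\in\mathbb{Z},\] and $\sum_{x\in\mathbb{Z}}V_0(0,x)=\sigma_\xi^2/\sigma_1^2$, where the series converges absolutely.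
   Context: $p(x,y)=p(y-x)$ and $p^k$ denotes the $k$-step transition probability. $\Delta_0(x)=\sum_{k\ge 0}\sum_{z\in\mathbb{Z}}\xi_{-k}(z)(p^k(x,z)-p^k(x-1,z))$ (convergent a.s. and in $L^2$). $q(x,y)=\sum_z p(0,z)p(x,y+z)$ is the symmetrized kernel, $q^k$ its $k$-step transitions, $a(x)=\sum_{k=0}^\infty[q^k(0,0)-q^k(x,0)]$ its potential kernel, and $\phi_q(\theta)=\sum_x q(0,x)e^{\iota\theta x}$, with $\iota=\sqrt{-1}$. *)

(* Defs.v *)
From HB Require Import structures.
From mathcomp Require Import all_boot all_order all_algebra.
From mathcomp Require Import all_classical all_reals all_analysis.
From mathcomp Require Import complex.
Set Implicit Arguments.
Unset Strict Implicit.
Unset Printing Implicit Defensive.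
Import Order.TTheory GRing.Theory Num.Theory ComplexField.
Import numFieldNormedType.Exports.
Local Open Scope classical_set_scope.
Local Open Scope ring_scope.

(* Sum over all of Z of a (finitely supported) function; this is mathcomp's
   finitely-supported big sum (all sums below are over finitely supported
   summands under the hypotheses of the theorem, since p has finite range). *)
Definition zsum (V : nmodType) (f : int -> V) : V := \sum_(z \in [set: int]) f z.

Fixpoint ptrans (R : realType) (p : int -> R) (k : nat) (x y : int) : R :=
  match k with
  | 0 => (x == y)%:R
  | k'.+1 => zsum (fun z => ptrans p k' x z * p (y - z))
  end.

Definition qker (R : realType) (p : int -> R) (x y : int) : R :=
  zsum (fun z => p z * p (y + z - x)).

Fixpoint qtrans (R : realType) (p : int -> R) (k : nat) (x y : int) : R :=
  match k with
  | 0 => (x == y)%:R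
  | k'.+1 => zsum (fun z => qtrans p k' x z * qker p z y)
  end.

Definition apot (R : realType) (p : int -> R) (x : int) : R :=
  limn (series (fun k => qtrans p k 0 0 - qtrans p k x 0)).

Definition expi (R : realType) (t : R) : R[i] := (cos t +i* sin t)%C.

Definition phiq (R : realType) (p : int -> R) (theta : R) : R[i] :=
  zsum (fun x => (qker p 0 x)%:C * expi (theta * x%:~R))%C.

Definition cintegral (R : realType) (f : R -> R[i]) (a b : R) : R[i] :=
  (Rintegral lebesgue_measure `[a, b] (fun t => complex.Re (f t)) +i*
   Rintegral lebesgue_measure `[a, b] (fun t => complex.Im (f t)))%C.

Definition pmean (R : realType) (p : int -> R) : R := zsum (fun x => x%:~R * p x).
Definition pvar (R : realType) (p : int -> R) : R :=
  zsum (fun x => (x%:~R - pmean p) ^+ 2 * p x).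

Definition is_add_subgroup (H : set int) : Prop :=
  H 0 /\ (forall a b, H a -> H b -> H (a + b)) /\ (forall a, H a -> H (- a)).

Definition strong_span1 (R : realType) (p : int -> R) : Prop :=
  forall u : int, forall H : set int, is_add_subgroup H ->
    (forall x, 0 < p x -> H (u + x)) -> H = [set: int].

Definition mutually_independent d (T : measurableType d) (R : realType)
  (P : probability T R) (I : eqType) (X : I -> T -> R) : Prop :=
  forall (s : seq I) (B : I -> set R), uniq s -> (forall i, measurable (B i)) ->
    P [set w | forall i, i \in s -> B i (X i w)] =
    ((\prod_(i <- s) fine (P (X i @^-1` B i)))%:E)%E.

Definition Delta0_partial d (T : measurableType d) (R : realType)
  (xi : int -> int -> T -> R) (p : int -> R) (x : int) (K : nat) (w : T) : R :=
  \sum_(k < K) zsum (fun z => xi (- (k%:Z)) z w * (ptrans p k x z - ptrans p k (x - 1) z)).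

(* Delta_0(x), the (a.s.) limit of the partial sums *)
Definition Delta0 d (T : measurableType d) (R : realType)
  (xi : int -> int -> T -> R) (p : int -> R) (x : int) (w : T) : R :=
  limn (Delta0_partial xi p x ^~ w).

Definition V0 d (T : measurableType d) (R : realType) (P : probability T R)
  (xi : int -> int -> T -> R) (p : int -> R) (x : int) : R :=
  fine ('E_P[fun w => (Delta0 xi p 0 w * Delta0 xi p x w)%R])%E.

(* Main.v *)
(* Write T_n for the Chebyshev polynomials, so that cos (n t) = T_n(cos t). The characteristic
   function of the symmetrized walk is Q(cos t) for a polynomial Q = sum_u q(u) T_|u| with
   Q(1) = 1, hence 1 - Q = (1 - X) g, and the span and variance hypotheses make g
   positive on [-1, 1], with g(1) = Q'(1) = 2 sigma_1^2. Everything is then expressed through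
   I_h(x) = int_{-pi}^{pi} h(cos t) / g(cos t) cos(x t) dt: the k-step transition probabilities
   are I_(Q^k g) / (2 pi), the sum over k of their second differences telescopes to I_1 / pi, and
   I_h decays exponentially because 1/g is a uniform limit of polynomials in cos t at a geometric
   rate. The total mass comes from 1 = g / g(1) + (1 - X) h, where I_((1 - X) h) telescopes.
   On the probabilistic side the increments of the partial sums of Delta_0 are orthogonal with
   variances whose tails beyond time 4^J are O(2^-J). With such a power rate, Rademacher-Menshov
   chaining gives both almost sure convergence and a square-integrable majorant of the partial
   sums, so that E[Delta_0(0) Delta_0(x)] is a limit by dominated convergence; independence of
   the noise is used only through pairwise orthogonality. *)
Require Import Defs.
From HB Require Import structures.
From mathcomp Require Import all_boot all_order all_algebra.
From mathcomp Require Import all_classical all_reals all_analysis.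
From mathcomp Require Import complex.
From mathcomp Require Import measurable_realfun.
From mathcomp Require Import zify ring lra.
Import Order.TTheory GRing.Theory Num.Theory ComplexField.
Import numFieldNormedType.Exports.
Local Open Scope classical_set_scope.
Local Open Scope ring_scope.
Set Implicit Arguments.
Unset Strict Implicit.
Unset Printing Implicit Defensive.

(** * Finitely supported sums and convolution powers over the integers *)

Definition zrange (N : nat) : seq int := [seq (i%:Z - N%:Z) | i <- iota 0 (N.*2).+1].

Lemma mem_zrange N z : (z \in zrange N) = (`|z|%N <= N)%N.
Proof.
apply/mapP/idP => [[k]|zN]; first by rewrite mem_iota => h ->; lia.
by exists (absz (z + N%:Z)); [rewrite mem_iota|]; lia.
Qed.

Lemma zrange_uniq N : uniq (zrange N).
Proof. by rewrite map_inj_uniq ?iota_uniq// => i j /= h; lia. Qed.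

(** A sum over an infinite support is 0 by convention, so additivity and exchange of sums are
    carried out inside an explicit window. *)
Definition zsupp {V : nmodType} (N : nat) (f : int -> V) :=
  forall z, (N < `|z|)%N -> f z = 0.

Lemma zsumE {V : nmodType} N (f : int -> V) :
  zsupp N f -> zsum f = \sum_(z <- zrange N) f z.
Proof.
move=> fN; rewrite /zsum (@fsbigE _ _ _ _ _ (zrange N)) ?zrange_uniq//.
  by apply: eq_bigl => z; rewrite in_setT.
by move=> z _; rewrite mem_zrange -ltnNge => /fN.
Qed.

Lemma eq_zsum {V : nmodType} (f g : int -> V) : f =1 g -> zsum f = zsum g.
Proof. by move=> fg; apply: eq_fsbigr => x _; exact: fg. Qed.

Lemma zsumD {V : nmodType} N (f g : int -> V) : zsupp N f -> zsupp N g ->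
  zsum (fun z => f z + g z) = zsum f + zsum g.
Proof.
move=> fN gN; rewrite (zsumE fN) (zsumE gN) (@zsumE _ N) ?big_split//.
by move=> z Nz; rewrite fN ?gN ?addr0.
Qed.

Lemma zsumZ {R : idomainType} (c : R) (f : int -> R) :
  zsum (fun z => c * f z) = c * zsum f.
Proof. by rewrite /zsum mulr_fsumr. Qed.

Lemma zsumZr {R : idomainType} (c : R) (f : int -> R) :
  zsum (fun z => f z * c) = zsum f * c.
Proof. by rewrite /zsum mulr_fsuml. Qed.

Lemma zsum_shift {V : nmodType} (u : int) (f : int -> V) :
  zsum (fun z => f (z + u)) = zsum f.
Proof.
rewrite /zsum [RHS](@reindex_fsbigT _ _ _ _ _ (fun z : int => z + u))//.
by exists (fun z => z - u) => z; [exact: addrK | exact: subrK].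
Qed.

Lemma zsum_opp {V : nmodType} (f : int -> V) : zsum (fun z => f (- z)) = zsum f.
Proof.
have bij : bijective (fun z : int => - z) by exists -%R; exact: opprK.
by rewrite /zsum [RHS](@reindex_fsbigT _ _ _ _ _ (fun z : int => - z)).
Qed.

Lemma zsum_delta {R : nzSemiRingType} (f : int -> R) (a : int) :
  zsum (fun z => (z == a)%:R * f z) = f a.
Proof.
rewrite (@zsumE _ (absz a)) => [|z az]; last first.
  by case: eqP az => [->|]; rewrite ?ltnn ?mul0r.
rewrite (bigD1_seq a) ?zrange_uniq ?mem_zrange//= eqxx mul1r big1 ?addr0//.
by move=> z /negPf ->; rewrite mul0r.
Qed.

Lemma zsum_exch {V : nmodType} N (f : int -> int -> V) :
  (forall y z, (N < `|y|)%N || (N < `|z|)%N -> f y z = 0) ->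
  zsum (fun y => zsum (f y)) = zsum (fun z => zsum (f^~ z)).
Proof.
move=> fN.
have e g : (forall y z, (N < `|y|)%N || (N < `|z|)%N -> g y z = 0) ->
    zsum (fun y => zsum (g y)) = \sum_(y <- zrange N) \sum_(z <- zrange N) g y z :> V.
  move=> gN; rewrite (@zsumE _ N) => [|y Ny].
    by apply: eq_bigr => y _; apply: zsumE => z Nz; rewrite gN ?Nz ?orbT.
  by rewrite (@zsumE _ 0) => [|z _]; rewrite ?big1// => *; rewrite gN ?Ny.
rewrite e// (e (fun z => f^~ z)) => [|y z]; first exact: exchange_big.
by rewrite orbC; exact: fN.
Qed.

Lemma zsum_ge0 {R : numDomainType} (f : int -> R) :
  (forall z, 0 <= f z) -> 0 <= zsum f.
Proof. by move=> f0; apply: fsumr_ge0 => z _; exact: f0. Qed.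

(** One-variable form of the translation-invariant kernels: both [ptrans] and [qtrans] at time [k]
    are convolution powers evaluated at [y - x]. *)
Fixpoint convpow {R : pzSemiRingType} (f : int -> R) (k : nat) (z : int) : R :=
  if k is k'.+1 then zsum (fun w => convpow f k' w * f (z - w)) else (z == 0)%:R.

(** For a probability [f] this is the law of the difference of two independent [f]-distributed
    steps. *)
Definition autocorr {R : pzSemiRingType} (f : int -> R) (u : int) : R :=
  zsum (fun z => f z * f (z + u)).

Section Convolution.
Context {R : idomainType}.
Implicit Types f g : int -> R.

Lemma convpow_supp f N k : zsupp N f -> zsupp (k * N) (convpow f k).
Proof.
move=> fN; elim: k => [|k IH] z /=; first by case: eqP => // ->.
move=> kz; rewrite /zsum big1// => w _.
have [/IH ->|kw] := ltnP (k * N)%N `|w|; first by rewrite mul0r.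
by rewrite [f _]fN ?mulr0//; move: kz kw; rewrite mulSn; lia.
Qed.

Lemma autocorr_supp f N : zsupp N f -> zsupp N.*2 (autocorr f).
Proof.
move=> fN u Nu; rewrite /autocorr /zsum big1// => z _.
have [/fN ->|zN] := ltnP N `|z|; first by rewrite mul0r.
by rewrite [f (z + u)]fN ?mulr0//; lia.
Qed.

Lemma autocorr_sym f u : autocorr f (- u) = autocorr f u.
Proof.
rewrite /autocorr -(zsum_shift u); apply: eq_zsum => z.
by rewrite addrK mulrC.
Qed.

(** The difference of two independent walks with step law [f] is itself a walk, with step law
    [autocorr f]. This turns overlaps of two time-[k] laws of [p] into [k] steps of [q]. *)
Lemma autocorr_convpow f N k u : zsupp N f ->
  autocorr (convpow f k) u = convpow (autocorr f) k u.
Proof.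
move=> fN; elim: k u => [|k IH] u /=.
  by rewrite /autocorr zsum_delta/= add0r.
set pi := convpow f k in IH *.
have piN : zsupp (k * N) pi by exact: convpow_supp.
pose B := (k * N + N + `|u|)%N.
transitivity (zsum (fun z => zsum (fun w => zsum (fun w' =>
    pi w * f (z - w) * (pi w' * f (z + u - w')))))).
  by apply: eq_zsum => z; rewrite -zsumZr; apply: eq_zsum => w; rewrite -zsumZ.
transitivity (zsum (fun w => zsum (fun w' => zsum (fun z =>
    pi w * f (z - w) * (pi w' * f (z + u - w')))))).
  rewrite (@zsum_exch _ B).
    apply: eq_zsum => w; apply: (@zsum_exch _ B) => z w' h.
    have [/piN ->|a] := ltnP (k * N)%N `|w|; first by rewrite !mul0r.
    have [/piN ->|b] := ltnP (k * N)%N `|w'|; first by rewrite mul0r mulr0.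
    by rewrite [f (z - w)]fN ?mulr0 ?mul0r//; rewrite /B in h; lia.
  move=> z w h; rewrite /zsum big1// => w' _.
  have [/piN ->|a] := ltnP (k * N)%N `|w|; first by rewrite !mul0r.
  by rewrite [f (z - w)]fN ?mulr0 ?mul0r//; rewrite /B in h; lia.
transitivity (zsum (fun w => zsum (fun w' => pi w * pi w' * autocorr f (u + w - w')))).
  apply: eq_zsum => w; apply: eq_zsum => w'.
  rewrite /autocorr -zsumZ -[RHS](zsum_shift (- w)); apply: eq_zsum => z.
  by rewrite mulrACA; congr (_ * (_ * f _)); ring.
(* Substituting [w' = v + w] isolates the displacement [v], whose weight is [autocorr pi v]. *)
transitivity (zsum (fun w => zsum (fun v => pi w * pi (v + w) * autocorr f (u - v)))).
  apply: eq_zsum => w; rewrite -(zsum_shift w); apply: eq_zsum => v.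
  by congr (_ * autocorr f _); ring.
rewrite (@zsum_exch _ (B + B)).
  apply: eq_zsum => v; rewrite zsumZr -IH; congr (_ * _).
  by apply: eq_zsum => w; rewrite addrC.
move=> w v h.
have [/piN ->|a] := ltnP (k * N)%N `|w|; first by rewrite !mul0r.
by rewrite (piN (v + w)) ?mulr0 ?mul0r//; rewrite /B in h; lia.
Qed.

End Convolution.

(** * Transition kernels as convolution powers *)

Section Kernels.
Context {R : realType} (p : int -> R).

Lemma ptransE k x y : ptrans p k x y = convpow p k (y - x).
Proof.
elim: k x y => [|k IH] x y /=; first by rewrite subr_eq0 eq_sym.
rewrite -[RHS](zsum_shift (- x)); apply: eq_zsum => z.
by rewrite IH; congr (_ * p _); ring.
Qed.

Lemma qkerE x y : qker p x y = autocorr p (y - x).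
Proof. by apply: eq_zsum => z; congr (_ * p _); ring. Qed.

Lemma qtransE k x y : qtrans p k x y = convpow (autocorr p) k (y - x).
Proof.
elim: k x y => [|k IH] x y /=; first by rewrite subr_eq0 eq_sym.
rewrite -[RHS](zsum_shift (- x)); apply: eq_zsum => z.
by rewrite IH qkerE; congr (_ * autocorr p _); ring.
Qed.

End Kernels.

(** * Chebyshev polynomials and integration over a period *)

Fixpoint cheb {R : nzRingType} (n : nat) : {poly R} :=
  if n is n'.+1 then
    if n' is n''.+1 then 'X *+ 2 * cheb n' - cheb n'' else 'X
  else 1.

Section Chebyshev.
Context {R : realType}.

Lemma cheb_ind2 (P : nat -> Prop) :
  P 0%N -> P 1%N -> (forall n, P n -> P n.+1 -> P n.+2) -> forall n, P n.
Proof.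
move=> P0 P1 PS n; suff [] : P n /\ P n.+1 by [].
by elim: n => // n [Pn PSn]; split=> //; exact: PS.
Qed.

Lemma chebSS n : cheb n.+2 = 'X *+ 2 * cheb n.+1 - cheb n :> {poly R}.
Proof. by []. Qed.

Lemma cheb_cos n (t : R) : (cheb n).[cos t] = cos (t * n%:R).
Proof.
elim/cheb_ind2: n => [||n IH1 IH2].
- by rewrite hornerC mulr0 cos0.
- by rewrite hornerX mulr1.
- rewrite chebSS !hornerE IH1 IH2.
  have -> : t * n.+2%:R = t * n.+1%:R + t by rewrite -[n.+2]addn1 natrD; ring.
  have -> : t * n%:R = t * n.+1%:R - t by rewrite -[n.+1]addn1 natrD; ring.
  by rewrite cosB cosD; ring.
Qed.

Lemma cheb_at1 n : (cheb n).[1 : R] = 1.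
Proof. by rewrite -cos0 cheb_cos mul0r cos0. Qed.

(** Differentiating the recurrence at 1 gives the recurrence of the squares. This is what makes the
    derivative of [charpoly2] at 1 a second moment. *)
Lemma deriv_cheb_at1 n : (cheb n)^`().[1 : R] = n%:R ^+ 2.
Proof.
elim/cheb_ind2: n => [||n IH1 IH2].
- by rewrite derivC hornerC expr0n.
- by rewrite derivX hornerC expr1n.
- rewrite chebSS derivB derivM derivMn derivX hornerD hornerN !(hornerE, hornerMn) IH1 IH2 cheb_at1.
  by rewrite -[n.+2]addn1 -[n.+1]addn1 !natrD; ring.
Qed.

End Chebyshev.

Section IntegralPi.
Context {R : realType}.
Notation mu := (@lebesgue_measure R).
Implicit Types f g F : R -> R.

Definition intpi f : R := Rintegral mu `[- pi, pi] f.

Lemma ltNpipi : - pi < pi :> R.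
Proof. by have := @pi_gt0 R; lra. Qed.

Lemma integrable_pi f : continuous f -> mu.-integrable `[- pi, pi] (EFin \o f).
Proof.
move=> cf; apply: continuous_compact_integrable; first exact: segment_compact.
exact: continuous_subspaceT.
Qed.

Lemma eq_intpi f g : f =1 g -> intpi f = intpi g.
Proof. by move=> fg; apply: eq_Rintegral => x _; exact: fg. Qed.

Lemma intpiD f g : continuous f -> continuous g ->
  intpi (fun t => f t + g t) = intpi f + intpi g.
Proof. by move=> cf cg; rewrite /intpi RintegralD//; exact: integrable_pi. Qed.

Lemma intpiZ c f : continuous f -> intpi (fun t => c * f t) = c * intpi f.
Proof. by move=> cf; rewrite /intpi RintegralZl//; exact: integrable_pi. Qed.

Lemma le_intpi f g : continuous f -> continuous g ->
  (forall t, - pi <= t <= pi -> f t <= g t) -> intpi f <= intpi g.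
Proof.
by move=> cf cg fg; apply: le_Rintegral => //; exact: integrable_pi.
Qed.

Lemma intpi_cst c : intpi (fun=> c) = c * (2 * pi).
Proof.
rewrite /intpi Rintegral_cst//= lebesgue_measure_itv/= lte_fin ltNpipi/=.
by rewrite opprK mulr2n mulrDl mul1r.
Qed.

Lemma normr_intpi f g : continuous f -> continuous g ->
  (forall t, - pi <= t <= pi -> `|f t| <= g t) -> `|intpi f| <= intpi g.
Proof.
move=> cf cg fg; apply: (le_trans (le_normr_Rintegral _ (integrable_pi cf))) => //.
apply: (@le_intpi (fun t => `|f t|)) => // t.
by apply: continuous_comp; [exact: cf|exact: norm_continuous].
Qed.

Lemma intpi_FTC f F : continuous f -> (forall t : R, is_derive t 1 F (f t)) ->
  intpi f = F pi - F (- pi).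
Proof.
move=> cf dF.
have cF : continuous F.
  move=> t; apply: differentiable_continuous.
  by apply/derivable1_diffP; have [] := dF t.
rewrite /intpi /Rintegral (@continuous_FTC2 _ _ F) ?ltNpipi//.
- exact: continuous_subspaceT.
- split => [x _||]; first by have [] := dF x.
    by apply: cvg_at_right_filter; exact: cF.
  by apply: cvg_at_left_filter; exact: cF.
- by move=> x _; rewrite derive1E; have [_] := dF x.
Qed.

Lemma sin_int_pi (n : nat) : sin (pi * n%:R) = 0 :> R.
Proof.
by rewrite -[X in sin X]add0r mulr_natr (alternatingn (@sinDpi R)) sin0 mulr0.
Qed.

Lemma continuous_cosM (c : R) : continuous (fun t : R => cos (t * c)).
Proof.
move=> t; apply: (@continuous_comp _ _ _ (fun t : R => t * c) cos).
  exact: mulrr_continuous.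
exact: continuous_cos.
Qed.

Lemma continuous_sinM (c : R) : continuous (fun t : R => sin (t * c)).
Proof.
move=> t; apply: (@continuous_comp _ _ _ (fun t : R => t * c) sin).
  exact: mulrr_continuous.
exact: continuous_sin.
Qed.

Lemma cos_absz (t : R) (x : int) : cos (t * x%:~R) = cos (t * `|x|%N%:R).
Proof.
case: (intP x) => [|n|n]; rewrite ?abszN ?absz_nat// mulrNz mulrN cosN.
by [].
Qed.

Lemma intpi_cos (x : int) : intpi (fun t => cos (t * x%:~R)) = (x == 0)%:R * (2 * pi).
Proof.
under eq_intpi do rewrite cos_absz.
rewrite -absz_eq0; case: `|x|%N => [|n].
  rewrite eqxx -intpi_cst; apply: eq_intpi => t.
  by rewrite mulr0 cos0.
have dF (t : R) : is_derive t 1 (fun t => n.+1%:R^-1 * sin (t * n.+1%:R)) (cos (t * n.+1%:R)).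
  have -> : (fun t => n.+1%:R^-1 * sin (t * n.+1%:R)) =
      (n.+1%:R^-1 : R) *: (sin \o (n.+1%:R *: (@id R))) :> (R -> R).
    by apply/funext => s; congr (_ * sin _); exact: mulrC.
  apply: is_derive_eq.
  by rewrite /GRing.scale/= mulr1 mulrCA mulVf ?pnatr_eq0// mulr1 mulrC.
rewrite (intpi_FTC (@continuous_cosM _) dF) mulNr sinN sin_int_pi.
by rewrite oppr0 mulr0 subrr mul0r.
Qed.

(** The substitution [t -> -t] preserves the interval, so the integral equals its own negative. *)
Lemma intpi_odd f : continuous f -> (forall t, f (- t) = - f t) -> intpi f = 0.
Proof.
move=> cf fN.
suff : intpi f = - intpi f by move=> h; lra.
rewrite -[RHS]mulN1r -intpiZ// {1}/intpi /Rintegral.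
have := @integration_by_substitution_oppr R f (- pi) pi.
rewrite !opprK => ->; first last.
- exact: continuous_subspaceT.
- exact/ltW/ltNpipi.
congr fine; apply: eq_integral => x _ /=.
by rewrite fN mulN1r.
Qed.

End IntegralPi.

(** * Elementary bounds on the cosine and a Cauchy kernel *)

Section Jordan.
Context {R : realType}.
Implicit Types t : R.

Lemma cos_ge_half t : 0 <= t <= pi / 4 -> 2^-1 <= cos t.
Proof.
move=> /andP[t0 t4]; have p0 := @pi_gt0 R.
have c0 : 0 <= cos t by apply: cos_ge0_pihalf; lra.
have : 0 <= cos (t *+ 2) by apply: cos_ge0_pihalf; rewrite (mulr2n t); lra.
rewrite cos_mulr2n => ?; nra.
Qed.

Lemma sin_ge_half t : 0 <= t <= pi / 4 -> t / 2 <= sin t.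
Proof.
move=> /andP[t0 t4].
have [|c] := @MVT_segment R sin cos 0 t t0.
- apply: continuous_subspaceT; exact: continuous_sin.
- rewrite in_itv/= sin0 !subr0 => /andP[c0 ct] ->.
  have : 2^-1 <= cos c by apply: cos_ge_half; lra.
  by nra.
Qed.

(** Halving the angle twice brings it into [[0, pi / 4]], where cosine is at least 1/2 and [sin s]
    at least [s / 2]. Hence [sin (t / 2) >= t / 8], and [1 - cos t] is twice its square. *)
Lemma cos_quadratic t : - pi <= t <= pi -> t ^+ 2 / 32 <= 1 - cos t.
Proof.
wlog t0 : t / 0 <= t => [h|/andP[_ tpi]].
  have [t0|t0 tpi] := leP 0 t; first exact: h.
  by rewrite -(sqrrN t) -cosN; apply: h; lra.
have t4 : 0 <= t / 4 <= pi / 4 by lra.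
have := cos_ge_half t4; have := sin_ge_half t4.
have -> : cos t = 1 - 2 * sin (t / 2) ^+ 2.
  have e : t = (t / 2) *+ 2 by rewrite -mulr_natr; lra.
  by rewrite {1}e cos_mulr2n sin2cos2 -mulr_natr; ring.
have -> : sin (t / 2) = 2 * (cos (t / 4) * sin (t / 4)).
  have -> : t / 2 = (t / 4) *+ 2 by rewrite -mulr_natr; lra.
  by rewrite sin_mulr2n -mulr_natr; ring.
move: (cos _) (sin _) => c s hs hc.
suff : t / 8 <= 2 * (c * s) by nra.
by nra.
Qed.

(** The induction rests on [(1 - s) (1 + (n + 1) s) <= 1 + n s]. *)
Lemma bernoulli_inv (s : R) n : 0 <= s <= 1 -> (1 - s) ^+ n * (1 + n%:R * s) <= 1.
Proof.
move=> /andP[s0 s1]; elim: n => [|n IH]; first by rewrite expr0 mul0r addr0 mulr1.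
apply: le_trans IH; rewrite exprSr -mulrA ler_wpM2l ?exprn_ge0 ?subr_ge0//.
have n0 : 0 <= n%:R :> R by [].
by rewrite -[n.+1]addn1 natrD; nra.
Qed.

(** The antiderivative is [a^-1 * atan (a * t)], and [atan] stays below [pi / 2]. The gain [1 / a]
    later becomes the rate [2^-J]. *)
Lemma intpi_cauchy (a : R) : 0 < a ->
  intpi (fun t => (1 + (a * t) ^+ 2)^-1) <= pi / a.
Proof.
move=> a0.
have c1 t : 1 + (a * t) ^+ 2 != 0 by rewrite gt_eqF//; nra.
have cf : continuous (fun t => (1 + (a * t) ^+ 2)^-1).
  move=> t; apply: cvgV => //; apply: cvgD; first exact: cvg_cst.
  apply: (@continuous_comp _ _ _ ( *%R a) (fun s => s ^+ 2)).
    exact: mulrl_continuous.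
  exact: exprn_continuous.
have dF t : is_derive t 1 (fun t => a^-1 * atan (a * t)) ((1 + (a * t) ^+ 2)^-1).
  have -> : (fun t => a^-1 * atan (a * t)) =
      (a^-1 : R) *: (atan \o (a *: (@id R))) :> (R -> R) by [].
  apply: is_derive_eq.
  by rewrite /GRing.scale/= mulr1 mulrCA mulVf ?gt_eqF// mulr1.
rewrite (intpi_FTC cf dF) mulrN atanN mulrN opprK -mulr2n mulrC.
rewrite -mulrnAl ler_wpM2r ?invr_ge0 ?ltW// mulr2n.
by have := atan_ltpi2 (a * pi); lra.
Qed.

End Jordan.

(** * Fourier coefficients of rational functions of the cosine *)

Section RationalFourier.
Context {R : realType} (g : {poly R}).
Hypothesis g_gt0 : forall c : R, -1 <= c <= 1 -> 0 < g.[c].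
Implicit Types (h : {poly R}) (x : int).

(** [2 * pi] times the Fourier coefficient at [x] of the even function [h(cos t) / g(cos t)]. Fixing
    the denominator makes it linear in [h]. *)
Definition ratfourier h x : R :=
  intpi (fun t => h.[cos t] / g.[cos t] * cos (t * x%:~R)).
Local Notation Fc := ratfourier.

Lemma cos_itv (t : R) : -1 <= cos t <= 1.
Proof. by rewrite cos_geN1 cos_le1. Qed.

Lemma horner_cos_neq0 t : g.[cos t] != 0.
Proof. by rewrite gt_eqF// g_gt0// cos_itv. Qed.

Lemma continuous_horner_cos h : continuous (fun t : R => h.[cos t]).
Proof.
move=> t; apply: (@continuous_comp _ _ _ cos (horner h)).
  exact: continuous_cos.
exact: continuous_horner.
Qed.

Lemma continuous_ratcos h : continuous (fun t : R => h.[cos t] / g.[cos t]).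
Proof.
move=> t; apply: cvgM; first exact: continuous_horner_cos.
by apply: cvgV; [exact: horner_cos_neq0|exact: continuous_horner_cos].
Qed.

Lemma continuous_ratcosM h (c : R) :
  continuous (fun t : R => h.[cos t] / g.[cos t] * cos (t * c)).
Proof.
by move=> t; apply: cvgM; [exact: continuous_ratcos|exact: continuous_cosM].
Qed.

Lemma ratfourierD h1 h2 x : Fc (h1 + h2) x = Fc h1 x + Fc h2 x.
Proof.
rewrite /Fc -intpiD; try exact: continuous_ratcosM.
by apply: eq_intpi => t; rewrite hornerD; ring.
Qed.

Lemma ratfourierZ a h x : Fc (a *: h) x = a * Fc h x.
Proof.
rewrite /Fc -intpiZ; last exact: continuous_ratcosM.
by apply: eq_intpi => t; rewrite hornerZ; ring.
Qed.

Lemma ratfourierN h x : Fc (- h) x = - Fc h x.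
Proof. by rewrite -scaleN1r ratfourierZ mulN1r. Qed.

Lemma ratfourierB h1 h2 x : Fc (h1 - h2) x = Fc h1 x - Fc h2 x.
Proof. by rewrite ratfourierD ratfourierN. Qed.

Lemma ratfourier0 x : Fc 0 x = 0.
Proof. by rewrite -(scale0r (0 : {poly R})) ratfourierZ mul0r. Qed.

Lemma ratfourier_sum (I : Type) (r : seq I) (F : I -> {poly R}) x :
  Fc (\sum_(k <- r) F k) x = \sum_(k <- r) Fc (F k) x.
Proof. by apply: (big_morph (Fc^~ x)) => [h1 h2|]; rewrite ?ratfourierD ?ratfourier0. Qed.

Lemma ratfourier_even h x : Fc h (- x) = Fc h x.
Proof. by apply: eq_intpi => t; rewrite mulrNz mulrN cosN. Qed.

Lemma ratfourier_chebM n h x :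
  Fc (cheb n * h) x = (Fc h (x + n%:Z) + Fc h (x - n%:Z)) / 2.
Proof.
rewrite /Fc -intpiD; try exact: continuous_ratcosM.
rewrite [RHS]mulrC -intpiZ; last first.
  by move=> t; apply: cvgD; exact: continuous_ratcosM.
apply: eq_intpi => t; rewrite hornerM cheb_cos intrD intrB -!pmulrn (mulrBr t) (mulrDr t).
by rewrite cosB cosD; field; exact: horner_cos_neq0.
Qed.

Lemma ratfourier_XM h x : Fc ('X * h) x = (Fc h (x + 1) + Fc h (x - 1)) / 2.
Proof. exact: (ratfourier_chebM 1). Qed.

Lemma ratfourier_self x : Fc g x = (x == 0)%:R * (2 * pi).
Proof.
rewrite -intpi_cos; apply: eq_intpi => t.
by rewrite divff ?mul1r ?horner_cos_neq0.
Qed.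

(** Once [g] cancels, the integrand is a cosine polynomial of degree below [size h] times
    [cos (x t)]. The induction strips one factor ['X], which moves the frequency by one. *)
Lemma ratfourier_polyM_eq0 h x : (size h <= `|x|)%N -> Fc (h * g) x = 0.
Proof.
elim/poly_ind: h x => [|h c IH] x; first by rewrite mul0r ratfourier0.
rewrite size_MXaddC; case: eqVneq => [->|h0] /=.
  case: eqVneq => [->|c0] /= hx; first by rewrite !mul0r addr0 mul0r ratfourier0.
  rewrite mul0r add0r mul_polyC ratfourierZ ratfourier_self (_ : (x == 0) = false) ?mul0r ?mulr0//.
  by apply/eqP => x0; rewrite x0 in hx.
move=> hx; have -> : (h * 'X + c%:P) * g = 'X * (h * g) + c *: g.
  by rewrite mulrDl mul_polyC; congr (_ + _); ring.
rewrite ratfourierD ratfourierZ ratfourier_self (_ : (x == 0) = false); last first.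
  by apply/eqP => x0; rewrite x0 in hx.
rewrite mul0r mulr0 addr0 ratfourier_XM !IH ?addr0 ?mul0r//. all: move: (size h) hx => s; lia.
Qed.

Lemma ratfourier_le h x (B : R) :
  (forall c : R, -1 <= c <= 1 -> `|h.[c]| <= B * g.[c]) -> `|Fc h x| <= B * (2 * pi).
Proof.
move=> hB; rewrite -intpi_cst; apply: normr_intpi.
- exact: continuous_ratcosM.
- by move=> t; exact: cvg_cst.
- move=> t _; rewrite normrM -[leRHS]mulr1 ler_pM// ?cos_max//.
  rewrite normrM normfV [X in _ / X]gtr0_norm ?g_gt0 ?cos_itv//.
  by rewrite ler_pdivrMr ?g_gt0 ?cos_itv// hB ?cos_itv.
Qed.

Lemma horner_dominated h :
  exists2 B : R, 0 < B & forall c : R, -1 <= c <= 1 -> `|h.[c]| <= B * g.[c].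
Proof.
have N11 : -1 <= 1 :> R by lra.
have [|d dI dmax] := @EVT_max R (fun c => `|h.[c]| / g.[c]) (-1) 1 N11.
  apply: continuous_in_subspaceT => c; rewrite inE/= in_itv/= => cI.
  apply: cvgM; last first.
    by apply: cvgV; [rewrite gt_eqF ?g_gt0|exact: continuous_horner].
  by apply: cvg_norm; exact: continuous_horner.
(* The added 1 keeps the constant positive even when [h] vanishes on the interval. *)
exists (`|h.[d]| / g.[d] + 1) => [|c cI].
  rewrite in_itv/= in dI; rewrite ltr_wpDl// divr_ge0//.
  by rewrite ltW// g_gt0.
rewrite -ler_pdivrMr ?g_gt0//; apply: le_trans (dmax _ _) _; rewrite ?in_itv//=.
by rewrite lerDl.
Qed.

Lemma horner_lower : exists2 m : R, 0 < m & forall c : R, -1 <= c <= 1 -> m <= g.[c].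
Proof.
have [B B0 hB] := horner_dominated 1.
exists B^-1; first by rewrite invr_gt0.
move=> c cI; have := hB c cI; rewrite hornerC normr1 => h.
by rewrite -[B^-1]mul1r ler_pdivrMr// mulrC.
Qed.

(* Neumann series: with [psi = 1 - g / B] in [0, rho], [1/g] is the trigonometric
   polynomial [(1 + psi + ... + psi^(N-1)) / B] of degree O(N), which has no
   frequency [x] once [N] is a small multiple of [|x|], up to [psi^N / g]. *)
Lemma ratfourier_exp_decay h : exists A c : R, [/\ 0 < A, 0 < c &
  forall x, `|Fc h x| <= A * expR (- c * `|x|%N%:R)].
Proof.
have [m m0 hm] := horner_lower.
have [d d0 hd] := horner_dominated h.
have N11 : -1 <= 1 :> R by lra.
have [|e eI emax] := @EVT_max R (horner g) (-1) 1 N11.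
  by apply: continuous_subspaceT; exact: continuous_horner.
rewrite in_itv/= in eI.
(* Adding [m] to the maximum of [g] gives [m < B], so [rho] is strictly positive and its logarithm
   is usable. *)
pose B := g.[e] + m; have me := hm _ eI.
have B0 : 0 < B by rewrite /B; lra.
pose rho := 1 - m / B.
have rho0 : 0 < rho by rewrite subr_gt0 ltr_pdivrMr// mul1r /B; lra.
have rho1 : rho < 1 by rewrite gtrDl oppr_lt0 divr_gt0.
pose psi := 1 - B^-1 *: g : {poly R}.
pose S (N : nat) := \sum_(n < N) psi ^+ n.
(* Each further term of the Neumann sum raises the degree by at most [L], so [h * S N] misses the
   frequency [x] once [N * L <= |x|]. *)
pose L := (size g + size h)%N.
have g0 : g != 0.
  by apply/eqP => g0; have := g_gt0 (@cos_itv 0); rewrite g0 horner0 ltxx.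
have L0 : (0 < L)%N by rewrite addn_gt0 size_poly_gt0 g0.
have sS (N : nat) : (size (h * S N)%R <= N * L)%N.
  elim: N => [|N IH]; first by rewrite /S big_ord0 mulr0 size_poly0.
  have -> : h * S N.+1 = h + psi * (h * S N).
    rewrite /S big_ord_recl expr0 mulrDr mulr1; congr (_ + _).
    rewrite mulrCA; congr (_ * _); rewrite big_distrr/=.
    by apply: eq_bigr => k _; rewrite exprS.
  apply: leq_trans (size_polyD _ _) _; rewrite geq_max.
  apply/andP; split; first by rewrite mulSn /L; lia.
  apply: leq_trans (size_polyMleq _ _) _.
  have : (size psi <= size g)%N.
    apply: leq_trans (size_polyD _ _) _; rewrite geq_max size_poly1 size_polyN.
    by rewrite size_poly_gt0 g0 size_scale_leq.
  by rewrite mulSn /L; move: IH; rewrite /L; lia.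
have split_h (N : nat) : h = h * psi ^+ N + B^-1 *: (h * S N * g).
  have e1 : 1 - psi ^+ N = S N * (B^-1 *: g).
    have := subrX1 psi N; rewrite -/(S N) => e1.
    rewrite -opprB e1 /psi -mulNr opprB opprB addrC subrK mulrC; congr (_ * _).
  by rewrite -mulrA scalerAr scalerAr -e1 mulrBr mulr1 addrC subrK.
(* This makes [rho] to the power [|x| / L] equal to [exp (- c |x|)]. The factor [rho^-1] in the
   constant below pays for rounding [|x| / L] down to [N]. *)
pose c := - ln rho / L%:R.
have c0 : 0 < c by rewrite divr_gt0 ?ltr0n// oppr_gt0 ln_lt0// rho0.
exists (d * (2 * pi) * rho^-1), c; split => // [|x].
  by rewrite !mulr_gt0 ?pi_gt0// ?invr_gt0.
pose N := (`|x| %/ L)%N.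
rewrite (split_h N) ratfourierD ratfourierZ ratfourier_polyM_eq0 ?mulr0 ?addr0; last first.
  by apply: leq_trans (sS _) _; exact: leq_trunc_div.
apply: (@le_trans _ _ (d * rho ^+ N * (2 * pi))).
  apply: ratfourier_le => y yI; rewrite hornerM normrM horner_exp normrX mulrAC.
  rewrite ler_pM ?exprn_ge0// ?hd// lerXn2r ?nnegrE//; first exact: ltW.
  have my := hm y yI; have gy : g.[y] <= g.[e] by apply: emax; rewrite in_itv.
  have -> : psi.[y] = 1 - g.[y] / B.
    by rewrite /psi hornerD hornerN hornerC hornerZ mulrC.
  rewrite ger0_norm ?subr_ge0 ?ler_pdivrMr ?mul1r//; last by rewrite /B; lra.
  by rewrite /rho lerD2l lerN2 ler_pM2r ?invr_gt0.
suff key : rho ^+ N <= rho^-1 * expR (- c * `|x|%N%:R).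
  rewrite -[leRHS]mulrA [leLHS]mulrAC ler_wpM2l//.
  by rewrite !mulr_ge0 ?pi_ge0// ltW.
rewrite mulrC ler_pdivlMr// -exprSr -[leLHS]lnK ?posrE ?exprn_gt0//.
rewrite ler_expR lnXn// -[ln rho *+ _]mulr_natl.
have -> : - c * `|x|%:R = `|x|%:R / L%:R * ln rho by rewrite /c; ring.
apply: ler_wnM2r; first by rewrite ltW// ln_lt0// rho0.
rewrite ler_pdivrMr ?ltr0n// -natrM ler_nat.
by rewrite ltnW// ltn_ceil.
Qed.

(** Since [Q(cos t) <= 1 - m t^2 / 32], the power [Q^N] concentrates near [t = 0] on the scale
    [N^(-1/2)], uniformly in [x]. Stating this along [4 ^ J] avoids square roots of [N] and suits
    the dyadic chaining. *)
Lemma ratfourier_powM_rate (Q : {poly R}) : (forall c : R, -1 <= c <= 1 -> 0 <= Q.[c]) ->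
  1 - Q = (1 - 'X) * g ->
  forall h, exists2 C : R, 0 <= C & forall J N x, (4 ^ J <= N)%N ->
    `|Fc (h * Q ^+ N) x| <= C * (2 ^+ J)^-1.
Proof.
move=> Q0 Qg h.
have [m m0 hm] := horner_lower.
have [d d0 hd] := horner_dominated h.
pose e := Num.sqrt (m / 32).
have e0 : 0 < e by rewrite sqrtr_gt0 divr_gt0.
have e2 : e ^+ 2 = m / 32 by rewrite sqr_sqrtr// divr_ge0 ?ltW.
exists (d * (pi / e)) => [|J N x JN].
  by rewrite mulr_ge0 ?divr_ge0 ?pi_ge0// ltW.
pose a := 2 ^+ J * e.
have a0 : 0 < a by rewrite mulr_gt0 ?exprn_gt0.
apply: (@le_trans _ _ (d * intpi (fun t => (1 + (a * t) ^+ 2)^-1))); last first.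
  rewrite -mulrA ler_wpM2l ?(ltW d0)//; apply: le_trans (intpi_cauchy a0) _.
  by rewrite /a invfM mulrCA mulrC.
have cf : continuous (fun t => (1 + (a * t) ^+ 2)^-1).
  move=> t; apply: cvgV; first by rewrite gt_eqF// ltr_wpDr// sqr_ge0.
  apply: cvgD; first exact: cvg_cst.
  apply: (@continuous_comp _ _ _ ( *%R a) (fun s => s ^+ 2)).
    exact: mulrl_continuous.
  exact: exprn_continuous.
rewrite -intpiZ//; apply: normr_intpi; first exact: continuous_ratcosM.
  by move=> t; apply: cvgM; [exact: cvg_cst|exact: cf].
move=> t tpi; rewrite normrM -[leRHS]mulr1 ler_pM// ?cos_max//.
have cI := cos_itv t.
have gt0 := g_gt0 cI.
rewrite hornerM horner_exp normrM normfV [X in _ / X]gtr0_norm//.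
rewrite normrM mulrAC ler_pM// ?divr_ge0 ?normr_ge0 ?(ltW gt0)//.
  by rewrite ler_pdivrMr// hd.
have Qc : Q.[cos t] = 1 - (1 - cos t) * g.[cos t].
  have := congr1 (horner^~ (cos t)) Qg.
  by rewrite hornerM !hornerD !hornerN !hornerC hornerX => <-; rewrite opprB addrC subrK.
have c1 : 0 <= 1 - cos t by rewrite subr_ge0 cos_le1.
have Q0t := Q0 _ cI.
pose s := m * (1 - cos t).
have s0 : 0 <= s by rewrite mulr_ge0// ltW.
have Qs : Q.[cos t] <= 1 - s.
  by rewrite Qc lerD2l lerN2 /s mulrC ler_wpM2l// hm.
have Q1 : Q.[cos t] <= 1 by lra.
have s1 : 0 <= 1 - s by exact: le_trans Qs.
rewrite normrX ger0_norm//.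
apply: le_trans (ler_wiXn2l Q0t Q1 JN) _.
apply: (@le_trans _ _ ((1 - s) ^+ (4 ^ J))); first by rewrite lerXn2r.
rewrite -[leRHS]mul1r ler_pdivlMr; last by rewrite ltr_pwDl// sqr_ge0.
(* [(1 - s)^N <= 1 / (1 + N s)] turns the bound into an integrable Cauchy kernel *)
apply: le_trans (@bernoulli_inv R s (4 ^ J) _); last by rewrite s0 -subr_ge0.
have -> : (a * t) ^+ 2 = (4 ^ J)%:R * (m * (t ^+ 2 / 32)).
  have -> : (4 ^ J)%:R = (2 ^+ J) ^+ 2 :> R by rewrite natrX exprAC; congr (_ ^+ _); ring.
  by rewrite /a !exprMn e2; ring.
rewrite ler_wpM2l ?exprn_ge0// lerD2l ler_wpM2l// ler_wpM2l ?(ltW m0)//.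
exact: cos_quadratic.
Qed.

End RationalFourier.

(** * The symmetrized walk *)

Section SymmetrizedWalk.
Context {R : realType} (p : int -> R) (M : nat).
Hypothesis p_ge0 : forall x, 0 <= p x.
Hypothesis p_sum1 : zsum p = 1.
Hypothesis p_supp : zsupp M p.
Implicit Types (x : int) (t : R).
Local Notation q := (autocorr p).

Lemma zsuppMr (f h : int -> R) N : zsupp N f -> zsupp N (fun z => f z * h z).
Proof. by move=> fN z /fN ->; rewrite mul0r. Qed.

Lemma ler_zsum (f : int -> R) N (a : int) : zsupp N f -> (forall z, 0 <= f z) ->
  f a <= zsum f.
Proof.
move=> fN f0; rewrite (zsumE fN).
have [aN|/fN ->] := leqP (absz a) N; last by apply: sumr_ge0.
by rewrite (bigD1_seq a) ?zrange_uniq ?mem_zrange//= lerDl sumr_ge0.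
Qed.

(** The mean of [F (Y - X)] for independent [X], [Y] of law [p]; total mass, second moment and
    characteristic function of [q] all follow from it. *)
Lemma zsum_autocorr (F : int -> R) :
  zsum (fun u => q u * F u) = zsum (fun z => p z * zsum (fun w => p w * F (w - z))).
Proof.
under eq_zsum do rewrite -zsumZr.
rewrite (@zsum_exch _ (M + M)) => [|u z h]; last first.
  have [/p_supp ->|a] := ltnP M `|z|; first by rewrite !mul0r.
  by rewrite [p (z + u)]p_supp ?mulr0 ?mul0r//; lia.
apply: eq_zsum => z; rewrite -zsumZ -[RHS](zsum_shift z); apply: eq_zsum => u.
by rewrite addrK mulrA (addrC u).
Qed.

Lemma autocorr_ge0 x : 0 <= q x.
Proof. by apply: zsum_ge0 => z; rewrite mulr_ge0. Qed.

Lemma autocorr_sum1 : zsum q = 1.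
Proof.
have := zsum_autocorr (fun=> 1).
under eq_zsum do rewrite mulr1.
move=> ->; rewrite -[RHS]p_sum1; apply: eq_zsum => z.
by under eq_zsum do rewrite mulr1; rewrite p_sum1 mulr1.
Qed.

Lemma centered_sum0 : zsum (fun x => p x * (x%:~R - pmean p)) = 0.
Proof.
under eq_zsum do rewrite mulrBr.
rewrite (@zsumD _ M (fun x => p x * x%:~R) (fun x => - (p x * pmean p))).
- have -> : zsum (fun x => - (p x * pmean p)) = - pmean p.
    under eq_zsum do rewrite -mulrN.
    by rewrite zsumZr p_sum1 mul1r.
  by rewrite /pmean; under eq_zsum do rewrite mulrC; rewrite subrr.
- exact: zsuppMr.
- by move=> z /p_supp ->; rewrite mul0r oppr0.
Qed.

Lemma pvarE : pvar p = zsum (fun x => p x * (x%:~R - pmean p) ^+ 2).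
Proof. by apply: eq_zsum => x; rewrite mulrC. Qed.

Lemma autocorr_second_moment : zsum (fun u => q u * u%:~R ^+ 2) = 2 * pvar p.
Proof.
rewrite (zsum_autocorr (fun u => u%:~R ^+ 2)).
pose m (x : int) : R := x%:~R - pmean p.
(* Centering at the mean kills the cross term, leaving the variance plus the squared deviation of
   [z]; averaging over [z] adds a second variance. *)
have inner z : zsum (fun w => p w * (w - z)%:~R ^+ 2) = pvar p + m z ^+ 2.
  have -> : (fun w => p w * (w - z)%:~R ^+ 2) =
    (fun w => p w * m w ^+ 2 + (- 2 * m z * (p w * m w) + m z ^+ 2 * p w)).
    by apply/funext => w; rewrite intrB /m; ring.
  rewrite (@zsumD _ M); first last.
  - by move=> w /p_supp ->; rewrite !mul0r !mulr0 addr0.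
  - exact: zsuppMr.
  rewrite (@zsumD _ M); first last.
  - by move=> w /p_supp ->; rewrite mulr0.
  - by move=> w /p_supp ->; rewrite mul0r mulr0.
  by rewrite -pvarE !zsumZ centered_sum0 p_sum1 mulr0 add0r mulr1.
under eq_zsum do rewrite inner mulrDr.
rewrite (@zsumD _ M); [|exact: zsuppMr..].
by rewrite zsumZr p_sum1 -pvarE; ring.
Qed.

(* [charpoly2.[cos t]] is [phi_q(t)], i.e. the squared modulus of the characteristic
   function of [p]. *)
Definition charpoly2 : {poly R} := \sum_(u <- zrange M.*2) q u *: cheb `|u|%N.
Local Notation Q := charpoly2.

Lemma horner_charpoly2 t : Q.[cos t] = zsum (fun u => q u * cos (t * u%:~R)).
Proof.
rewrite horner_sum (@zsumE _ M.*2); last exact/zsuppMr/autocorr_supp.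
by apply: eq_bigr => u _; rewrite hornerZ cheb_cos cos_absz.
Qed.

(** Expanding [cos (t (w - z))] separates the two sums. Being a sum of squares gives nonnegativity
    on [[-1, 1]], hence monotone powers. *)
Lemma horner_charpoly2_sqr t : Q.[cos t] =
  zsum (fun z => p z * cos (t * z%:~R)) ^+ 2 + zsum (fun z => p z * sin (t * z%:~R)) ^+ 2.
Proof.
rewrite horner_charpoly2 (zsum_autocorr (fun u => cos (t * u%:~R))).
set C := zsum (fun z => p z * cos _); set S := zsum (fun z => p z * sin _).
have inner z : zsum (fun w => p w * cos (t * (w - z)%:~R)) =
    cos (t * z%:~R) * C + sin (t * z%:~R) * S.
  rewrite -!zsumZ -(@zsumD _ M) => [|w /p_supp ->|w /p_supp ->]; last 2 first.
  - by rewrite mul0r mulr0.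
  - by rewrite mul0r mulr0.
  by apply: eq_zsum => w; rewrite intrB mulrBr cosB; ring.
under eq_zsum do rewrite inner mulrDr !mulrA.
by rewrite (@zsumD _ M) ?zsumZr ?expr2// => z /p_supp ->; rewrite !mul0r.
Qed.

Lemma acos_itv (c : R) : -1 <= c <= 1 -> exists t, c = cos t.
Proof. by move=> cI; exists (acos c); rewrite acosK// in_itv. Qed.

Lemma charpoly2_ge0 (c : R) : -1 <= c <= 1 -> 0 <= Q.[c].
Proof.
by move=> /acos_itv[t ->]; rewrite horner_charpoly2_sqr addr_ge0 ?sqr_ge0.
Qed.

Lemma charpoly2_at1 : Q.[1] = 1.
Proof.
have := horner_charpoly2 0; rewrite cos0 => ->.
rewrite -[RHS]autocorr_sum1; apply: eq_zsum => u.
by rewrite mul0r cos0 mulr1.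
Qed.

Lemma deriv_charpoly2_at1 : Q^`().[1] = 2 * pvar p.
Proof.
rewrite raddf_sum/= horner_sum -autocorr_second_moment (@zsumE _ M.*2); last first.
  exact/zsuppMr/autocorr_supp.
apply: eq_bigr => u _; rewrite derivZ hornerZ deriv_cheb_at1; congr (_ * _).
by rewrite -[in RHS](real_normK (@num_real R u%:~R)) -intr_norm -abszE -pmulrn.
Qed.

(** Total mass 1 makes 1 a root of [1 - Q]; differentiating the factorization at 1 gives
    [g(1) = Q'(1)], the second moment of [q]. *)
Lemma charpoly2_factor : exists2 g : {poly R}, 1 - Q = (1 - 'X) * g & g.[1] = 2 * pvar p.
Proof.
have : root (1 - Q) 1 by rewrite /root hornerD hornerN hornerC charpoly2_at1 subrr.
move=> /factor_theorem[h Qh].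
have Qg : 1 - Q = (1 - 'X) * - h by rewrite Qh; ring.
exists (- h) => //; rewrite -deriv_charpoly2_at1.
have := congr1 (fun f : {poly R} => f^`().[1]) Qg => /=.
rewrite derivM !derivB derivX -polyC1 derivC !sub0r.
by rewrite !hornerE => e; lra.
Qed.

Hypothesis p_span : strong_span1 p.
Hypothesis pvar_gt0 : 0 < pvar p.

(** If [Q(cos t)] reached 1, the integers [n] with [cos (t n) = 1] would form a subgroup containing
    all differences [x - x0] of support points. The span condition with [u = - x0] then puts 1 in
    it, so [cos t = 1]. *)
Lemma charpoly2_lt1 (c : R) : -1 <= c < 1 -> Q.[c] < 1.
Proof.
move=> /andP[c1 c2]; have [t ct] : exists t, c = cos t by apply: acos_itv; lra.
have [x0 px0] : exists x, 0 < p x.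
  apply/not_existsP => h; have : zsum p = 0.
    rewrite /zsum big1// => x _; apply/eqP; rewrite eq_le p_ge0 andbT leNgt.
    exact/negP/h.
  by rewrite p_sum1 => /eqP; rewrite oner_eq0.
rewrite ltNge; apply/negP => Q1.
pose H := [set n : int | cos (t * n%:~R) = 1].
have Hsin n : H n -> sin (t * n%:~R) = 0.
  by rewrite /H/= => h; apply: cos1sin0; rewrite h normr1.
have sub : is_add_subgroup H.
  split; first by rewrite /H/= mulr0 cos0.
  split=> [a b Ha Hb|a Ha].
    by rewrite /H/= intrD mulrDr cosD (Hsin a Ha) mul0r subr0 Ha Hb mulr1.
  by rewrite /H/= intrN mulrN cosN.
have : H 1.
  rewrite (p_span (u := - x0) sub)// => x px.
  have le1 u : 0 <= q u * (1 - cos (t * u%:~R)).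
    by rewrite mulr_ge0 ?autocorr_ge0// subr_ge0 cos_le1.
  have qN : zsupp M.*2 q by exact: autocorr_supp.
  (* The nonnegative terms [q u * (1 - cos (t u))] add up to [1 - Q(c) <= 0], so no single term can
     be positive. *)
  have : q (- x0 + x) * (1 - cos (t * (- x0 + x)%:~R)) <= 0.
    apply: le_trans (ler_zsum _ _ le1) _; first exact: (zsuppMr _ qN).
    rewrite (_ : zsum _ = 1 - Q.[c]) ?subr_le0//.
    rewrite ct horner_charpoly2 -[X in _ = X - _]autocorr_sum1.
    under eq_zsum do rewrite mulrBr mulr1.
    rewrite (@zsumD _ M.*2)//; last by move=> u /qN ->; rewrite mul0r oppr0.
    congr (_ + _); under eq_zsum do rewrite -mulN1r.
    by rewrite zsumZ mulN1r.
  have q0 : 0 < q (- x0 + x).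
    apply: (@lt_le_trans _ _ (p x0 * p (x0 + (- x0 + x)))).
      by rewrite addrA subrr add0r mulr_gt0.
    apply: (@ler_zsum (fun z => p z * p (z + (- x0 + x))) M x0).
      exact: zsuppMr.
    by move=> z; rewrite mulr_ge0.
  rewrite pmulr_rle0// subr_le0 => h; apply/eqP.
  by rewrite eq_le cos_le1.
by rewrite /H/= mulr1 -ct => h; rewrite h ltxx in c2.
Qed.

Lemma charpoly2_factor_gt0 (g : {poly R}) :
  1 - Q = (1 - 'X) * g -> g.[1] = 2 * pvar p ->
  forall c : R, -1 <= c <= 1 -> 0 < g.[c].
Proof.
move=> Qg g1 c /andP[c1]; rewrite le_eqVlt => /orP[/eqP ->|c2].
  by rewrite g1 mulr_gt0.
have := congr1 (horner^~ c) Qg.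
rewrite hornerM !hornerD !hornerN !hornerC hornerX => e.
have := charpoly2_lt1 (c := c); rewrite c1 c2 => /(_ isT) h.
by rewrite -(@pmulr_rgt0 _ (1 - c)) ?subr_gt0// -e subr_gt0.
Qed.

End SymmetrizedWalk.

(** * Limits from geometric and exponential rates *)

Section RateLimit.
Context {R : realType}.

Lemma pow2_rate_cvg0 (f : nat -> R) (C : R) :
  (forall J N, (4 ^ J <= N)%N -> `|f N| <= C * (2 ^+ J)^-1) ->
  f n @[n --> \oo] --> 0.
Proof.
move=> fC; apply/cvgr0Pnorm_lt => e e0.
pose J := Num.bound (`|C| / e).
near=> N; apply: (@le_lt_trans _ _ (C * (2 ^+ J)^-1)).
  by apply: fC; near: N; exact: nbhs_infty_ge.
rewrite ltr_pdivrMr ?exprn_gt0//; apply: (le_lt_trans (ler_norm C)).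
have : `|C| / e < J%:R by apply: archi_boundP; rewrite divr_ge0// ltW.
rewrite ltr_pdivrMr// => /lt_le_trans; apply.
by rewrite mulrC ler_wpM2l ?(ltW e0)// -natrX ler_nat ltnW// ltn_expl.
Unshelve. all: by end_near. Qed.

(** Pairing [n] with [-(n + 1)] runs through the integers exactly once, and each pair is dominated
    by [2 A exp (- c n)]. *)
Lemma exp_decay_cvg_series (V : int -> R) (A c : R) : 0 < A -> 0 < c ->
  (forall x, `|V x| <= A * expR (- c * `|x|%N%:R)) ->
  cvgn (series (fun n : nat => `|V n%:Z| + `|V (- (n.+1)%:Z)|)).
Proof.
move=> A0 c0 hV.
apply: (@series_le_cvg _ _ (geometric (A + A) (expR (- c)))) => [n|n|n|].
- by rewrite addr_ge0.
- by rewrite /= mulr_ge0 ?exprn_ge0 ?expR_ge0// addr_ge0 ?ltW.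
- rewrite /= mulrDl -expRM_natl [_ * - c]mulrC; apply: lerD.
    exact: hV.
  apply: le_trans (hV _) _; rewrite ler_pM2l// ler_expR abszN absz_nat.
  by apply: ler_wnM2l; rewrite ?ler_nat// oppr_le0 ltW.
- apply: is_cvg_geometric_series.
  by rewrite ger0_norm ?expR_ge0// expR_lt1 oppr_lt0.
Qed.

Lemma exp_decay_cvg0 (V : int -> R) (A c : R) : 0 < A -> 0 < c ->
  (forall x, `|V x| <= A * expR (- c * `|x|%N%:R)) ->
  V n%:Z @[n --> \oo] --> 0.
Proof.
move=> A0 c0 hV; apply/norm_cvg0P.
apply: (@squeeze_cvgr _ _ _ _ (fun=> 0) (geometric A (expR (- c)))).
- near=> n; rewrite normr_ge0/=; apply: le_trans (hV _) _.
  by rewrite absz_nat -expRM_natl [_ * - c]mulrC.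
- exact: cvg_cst.
- apply: cvg_geometric.
  by rewrite ger0_norm ?expR_ge0// expR_lt1 oppr_lt0.
Unshelve. all: by end_near. Qed.

End RateLimit.

(** * Fourier representation of the walk and of its potential kernel *)

Section PotentialKernel.
Context {R : realType} (p : int -> R) (M : nat) (g : {poly R}).
Hypothesis p_ge0 : forall x, 0 <= p x.
Hypothesis p_sum1 : zsum p = 1.
Hypothesis p_supp : zsupp M p.
Hypothesis g_gt0 : forall c : R, -1 <= c <= 1 -> 0 < g.[c].
Local Notation q := (autocorr p).
Local Notation Q := (charpoly2 p M).
Hypothesis Qg : 1 - Q = (1 - 'X) * g.
Hypothesis g_at1 : g.[1] = 2 * pvar p.
Local Notation Fc := (ratfourier g).
Implicit Types (x : int) (t : R).

(** Multiplying by the characteristic function is convolving with [q]. Each Chebyshev term averages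
    the shifts by [u] and [-u], and the symmetry of [q] merges them. *)
Lemma ratfourier_charpoly2M (h : {poly R}) x :
  Fc (Q * h) x = zsum (fun w => Fc h w * q (x - w)).
Proof.
have qN : zsupp M.*2 q by exact: autocorr_supp.
have -> : zsum (fun w => Fc h w * q (x - w)) = zsum (fun u => q u * Fc h (x + u)).
  rewrite -(zsum_shift x); apply: eq_zsum => u.
  by rewrite opprD addrCA subrr addr0 autocorr_sym mulrC addrC.
transitivity ((zsum (fun u => q u * Fc h (x + u)) + zsum (fun u => q u * Fc h (x - u))) / 2).
  rewrite -(@zsumD _ M.*2) -?zsumZr; [|exact: zsuppMr..].
  rewrite (@zsumE _ M.*2); last by move=> u /qN ->; rewrite !mul0r addr0 mul0r.
  rewrite /charpoly2 mulr_suml ratfourier_sum//; apply: eq_bigr => u _.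
  rewrite -scalerAl ratfourierZ// ratfourier_chebM// -mulrDr -mulrA; congr (_ * (_ / _)).
  by case: (intP u) => [|n|n]; rewrite ?abszN ?absz_nat// addrC opprK.
rewrite -[X in _ + X]zsum_opp.
have -> : zsum (fun u => q (- u) * Fc h (x - - u)) = zsum (fun u => q u * Fc h (x + u)).
  by apply: eq_zsum => u; rewrite opprK autocorr_sym.
by field.
Qed.

(** Fourier inversion: the factor [g] cancels the built-in denominator, so [k = 0] gives a point
    mass, and each further [Q] is one step of [q]. *)
Lemma convpow_ratfourier k x : convpow q k x = (2 * pi)^-1 * Fc (Q ^+ k * g) x.
Proof.
have p0 : 2 * pi != 0 :> R by rewrite mulf_neq0// gt_eqF// pi_gt0.
elim: k x => [|k IH] x /=; first by rewrite expr0 mul1r ratfourier_self// mulrCA mulVf ?mulr1.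
rewrite exprS -mulrA ratfourier_charpoly2M -zsumZ; apply: eq_zsum => w.
by rewrite IH mulrA.
Qed.

(* [sigma_xi^2 * disc_corr k x] is the covariance of the [k]-th terms of [Delta_0(0)] and
   [Delta_0(x)]. *)
Definition disc_corr k x : R :=
  2 * convpow q k x - convpow q k (x - 1) - convpow q k (x + 1).

(** Taking second differences multiplies the symbol by [2 (1 - X)]. Since [(1 - X) g = 1 - Q], the
    sum becomes that of [(1 - Q) Q^k], which telescopes. *)
Lemma sum_disc_corr K x :
  \sum_(k < K) disc_corr k x = pi^-1 * (Fc 1 x - Fc (Q ^+ K) x).
Proof.
have p0 : pi != 0 :> R by rewrite gt_eqF// pi_gt0.
have -> : Fc 1 x - Fc (Q ^+ K) x = \sum_(k < K) Fc ((1 - Q) * Q ^+ k) x.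
  rewrite -ratfourierB// -ratfourier_sum//; congr (Fc _ x).
  by rewrite -mulr_sumr -[LHS]opprB subrX1 -mulNr opprB.
rewrite mulr_sumr; apply: eq_bigr => k _.
have -> : (1 - Q) * Q ^+ k = Q ^+ k * g - 'X * (Q ^+ k * g) by rewrite Qg; ring.
rewrite ratfourierB// ratfourier_XM// /disc_corr !convpow_ratfourier.
by move: p0; generalize (pi : R) => P p0; field.
Qed.

Lemma ratfourier_charpoly2X_rate (h : {poly R}) : exists2 C : R, 0 <= C &
  forall J N x, (4 ^ J <= N)%N -> `|Fc (h * Q ^+ N) x| <= C * (2 ^+ J)^-1.
Proof. by apply: ratfourier_powM_rate => //; exact: charpoly2_ge0. Qed.

Lemma ratfourier_charpoly2X_cvg0 (h : {poly R}) x : Fc (h * Q ^+ N) x @[N --> \oo] --> 0.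
Proof.
have [C _ hC] := ratfourier_charpoly2X_rate h.
by apply: (@pow2_rate_cvg0 _ _ C) => J N; exact: hC.
Qed.

Lemma cvg_sum_disc_corr x :
  \sum_(k < K) disc_corr k x @[K --> \oo] --> pi^-1 * Fc 1 x.
Proof.
under eq_fun do rewrite sum_disc_corr.
have -> : pi^-1 * Fc 1 x = pi^-1 * (Fc 1 x - 0) by rewrite subr0.
apply: cvgMl_tmp; apply: cvgB; first exact: cvg_cst.
under eq_fun do rewrite -[_ ^+ _]mul1r.
exact: ratfourier_charpoly2X_cvg0.
Qed.

(** The [k]-th term has symbol [(1 - T_|x|) Q^k g]. As [1 - T_|x|] vanishes at 1, it contains a
    factor [X - 1], which combines with [g] into [Q - 1] and makes the series telescope. *)
Lemma cvg_apot x : series (fun k => qtrans p k 0 0 - qtrans p k x 0) n @[n --> \oo] -->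
  apot p x.
Proof.
suff h : cvgn (series (fun k => qtrans p k 0 0 - qtrans p k x 0)) by exact: h.
have /factor_theorem[U TU] : root (1 - cheb `|x|%N : {poly R}) 1.
  by rewrite /root hornerD hornerN hornerC cheb_at1 subrr.
have -> : series (fun k => qtrans p k 0 0 - qtrans p k x 0) =
    (fun K => (2 * pi)^-1 * (Fc (- U) 0 - Fc (- U * Q ^+ K) 0)).
  apply/funext => K; rewrite /series/= big_mkord -ratfourierB//.
  have -> : - U - - U * Q ^+ K = \sum_(k < K) (1 - cheb `|x|%N) * (Q ^+ k * g).
    rewrite TU -mulr_sumr -mulr_suml.
    have -> : - U - - U * Q ^+ K = U * (Q ^+ K - 1) by ring.
    rewrite subrX1 -[Q - 1]opprB Qg polyC1; ring.
  rewrite ratfourier_sum// mulr_sumr; apply: eq_bigr => k _.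
  rewrite !qtransE !sub0r oppr0 !convpow_ratfourier -mulrBr; congr (_ * _).
  rewrite mulrBl mul1r ratfourierB// ratfourier_chebM// sub0r add0r !ratfourier_even; congr (_ - _).
  by case: (intP x) => [|n|n]; rewrite ?abszN ?absz_nat ?ratfourier_even; field.
apply/cvg_ex; exists ((2 * pi)^-1 * (Fc (- U) 0 - 0)).
apply: cvgMl_tmp; apply: cvgB; first exact: cvg_cst.
exact: ratfourier_charpoly2X_cvg0.
Qed.

(** The return probabilities cancel in the second difference, so the partial sums already coincide
    with those of [disc_corr]. *)
Lemma apot_second_diff x :
  apot p (x - 1) + apot p (x + 1) - 2 * apot p x = pi^-1 * Fc 1 x.
Proof.
pose S y := series (fun k => qtrans p k 0 0 - qtrans p k y 0).
have h : S (x - 1) K + S (x + 1) K - 2 * S x K @[K --> \oo] -->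
    apot p (x - 1) + apot p (x + 1) - 2 * apot p x.
  apply: cvgB; first by apply: cvgD; exact: cvg_apot.
  by apply: cvgMl_tmp; exact: cvg_apot.
suff e : (fun K => S (x - 1) K + S (x + 1) K - 2 * S x K) =
    (fun K => \sum_(k < K) disc_corr k x).
  by rewrite e in h; exact: cvg_unique h (@cvg_sum_disc_corr x).
rewrite /S; apply/funext => K; rewrite /series /= !big_mkord mulr_sumr -big_split -sumrB/=.
apply: eq_bigr => k _; rewrite /disc_corr !qtransE !sub0r.
have sym y : convpow q k (- y) = convpow q k y by rewrite !convpow_ratfourier ratfourier_even.
by rewrite !sym; ring.
Qed.

(** In [1 = g / g(1) + (1 - X) h], the first term contributes [2 pi / g(1)] at the origin only, and
    the second is a discrete Laplacian whose sum is a vanishing boundary term. *)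
Lemma ratfourier_sum_cvg : series (fun n : nat => Fc 1 n%:Z + Fc 1 (- n.+1%:Z)) N @[N --> \oo] -->
  pi / pvar p.
Proof.
have g1 : g.[1] != 0 by rewrite gt_eqF// g_gt0//; lra.
have v0 : pvar p != 0 by move: g1; rewrite g_at1 mulf_eq0 negb_or => /andP[].
have /factor_theorem[h' h'E] : root (1 - g.[1]^-1 *: g) 1.
  by rewrite /root hornerD hornerN hornerC hornerZ mulVf// subrr.
pose h := - h'.
have hE : 1 = g.[1]^-1 *: g + (h - 'X * h).
  by rewrite /h -[LHS](subrK (g.[1]^-1 *: g)) h'E polyC1; ring.
have e x : Fc 1 x = pi / pvar p * (x == 0)%:R + (Fc h x - (Fc h (x + 1) + Fc h (x - 1)) / 2).
  rewrite hE ratfourierD// ratfourierZ// ratfourierB// ratfourier_XM// ratfourier_self//; congr (_ + _).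
  by rewrite g_at1; generalize (pi : R) => P; field.
have [A [c [A0 c0 hc]]] := ratfourier_exp_decay g_gt0 h.
have w0 : Fc h n%:Z @[n --> \oo] --> 0 by exact: exp_decay_cvg0 hc.
(* The sum runs over the asymmetric window from [-(N + 1)] to [N]; by evenness the boundary values
   at [N + 1] cancel, leaving those at [N] and [N + 2]. *)
have part N : series (fun n : nat => Fc 1 n%:Z + Fc 1 (- n.+1%:Z)) N.+1 =
    pi / pvar p + (Fc h N%:Z - Fc h N.+2%:Z) / 2.
  elim: N => [|N IH].
    rewrite /series/= big_nat1 ratfourier_even !e/= add0r sub0r ratfourier_even.
    rewrite (_ : (1%:Z + 1) = 2%:Z)// subrr mulr1 mulr0.
    by generalize (pi : R) => P; field.
  rewrite seriesSr IH ratfourier_even !e/= !mulr0 !add0r.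
  have -> : N.+1%:Z + 1 = N.+2%:Z by lia.
  have -> : N.+1%:Z - 1 = N%:Z by lia.
  have -> : N.+2%:Z + 1 = N.+3%:Z by lia.
  have -> : N.+2%:Z - 1 = N.+1%:Z by lia.
  by generalize (pi : R) => P; field.
rewrite -cvg_shiftS/=; under eq_fun do rewrite part.
have w2 : Fc h n.+2%:Z @[n --> \oo] --> 0.
  have := w0; rewrite -(@cvg_shiftn 2) /=.
  by under eq_fun do rewrite addn2.
have wB : (Fc h n%:Z - Fc h n.+2%:Z) / 2 @[n --> \oo] --> (0 - 0 : R) / 2.
  by apply: cvgMr_tmp; exact: (cvgB w0 w2).
have lim : pi / pvar p + (Fc h n%:Z - Fc h n.+2%:Z) / 2 @[n --> \oo] -->
    pi / pvar p + (0 - 0) / 2.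
  by apply: cvgD; [exact: cvg_cst|exact: wB].
by rewrite subr0 mul0r addr0 in lim.
Qed.

Lemma complex_sum (I : Type) (r : seq I) (F G : I -> R) :
  \sum_(k <- r) (F k +i* G k)%C = ((\sum_(k <- r) F k) +i* (\sum_(k <- r) G k))%C.
Proof.
elim: r => [|k r IH]; first by rewrite !big_nil.
by rewrite !big_cons IH; apply/eqP; rewrite eq_complex/= !eqxx.
Qed.

Lemma phiqE t : phiq p t = (Q.[cos t])%:C%C.
Proof.
have qN : zsupp M.*2 q by exact: autocorr_supp.
rewrite /phiq (@zsumE _ M.*2); last first.
  by move=> u /qN qu; rewrite qkerE subr0 qu mul0r.
rewrite (eq_bigr (fun u => (q u * cos (t * u%:~R) +i* (q u * sin (t * u%:~R)))%C)).
  rewrite complex_sum -!zsumE; try exact: zsuppMr.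
  rewrite -(horner_charpoly2 p_supp); apply/eqP; rewrite eq_complex/= eqxx/=.
  have := zsum_opp (fun u => q u * sin (t * u%:~R)).
  under eq_zsum do rewrite autocorr_sym mulrNz mulrN sinN mulrN -mulN1r.
  by rewrite zsumZ mulN1r => h; apply/eqP; lra.
move=> u _; rewrite qkerE subr0; apply/eqP.
by rewrite eq_complex/= !mul0r subr0 addr0 !eqxx.
Qed.

(** The quotient in the theorem is 0/0 at [t = 0], where division by zero returns 0 instead of the
    limit; a single point does not affect the integral. *)
Lemma intpi_punctured (f h : R -> R) : continuous h ->
  (forall t, - pi <= t <= pi -> t != 0 -> f t = h t) -> intpi f = intpi h.
Proof.
move=> ch fh; rewrite /intpi /Rintegral; congr fine.
have mD : measurable (`[- pi, pi]%classic `\ (0 : R)) by exact: measurableD.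
have mh : measurable_fun (`[- pi, pi]%classic `\ (0 : R)) h.
  by apply: subspace_continuous_measurable_fun => //; exact: continuous_subspaceT.
have eqfh : {in `[- pi, pi]%classic `\ (0 : R), f =1 h}.
  by move=> t; rewrite inE/= in_itv/= => -[tI /eqP t0]; exact: fh.
rewrite -[LHS](@integral_setD1 _ _ 0)//; last first.
  by apply/measurable_EFinP; apply: eq_measurable_fun mh => t tI; rewrite eqfh.
rewrite -[RHS](@integral_setD1 _ _ 0)//; last exact/measurable_EFinP.
by apply: eq_integral => t tI; rewrite eqfh.
Qed.

(** Away from 0 the factor [1 - cos t] cancels and leaves [1 / g(cos t)]. The imaginary part is
    odd. *)
Lemma cintegral_ratfourier x :
  cintegral (fun theta => (((1 - cos theta)%:C / (1 - phiq p theta))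
                           * expi (theta * x%:~R))%C) (- pi) pi = (Fc 1 x)%:C%C.
Proof.
have e t : - pi <= t <= pi -> t != 0 ->
   (((1 - cos t)%:C / (1 - phiq p t)) * expi (t * x%:~R))%C =
   ((1 : {poly R}).[cos t] / g.[cos t] * cos (t * x%:~R) +i*
    ((1 : {poly R}).[cos t] / g.[cos t] * sin (t * x%:~R)))%C.
  move=> tI t0; rewrite phiqE.
  have c1 : 1 - cos t != 0.
    rewrite gt_eqF//; apply: lt_le_trans (cos_quadratic tI).
    by rewrite divr_gt0// exprn_even_gt0.
  have := congr1 (horner^~ (cos t)) Qg.
  rewrite hornerM !hornerD !hornerN !hornerC hornerX => h.
  have -> : (1 - (Q.[cos t])%:C)%C = ((1 - cos t) * g.[cos t])%:C%C.
    by rewrite -h rmorphB.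
  have -> : ((1 - cos t)%:C / ((1 - cos t) * g.[cos t])%:C)%C = (1 / g.[cos t])%:C%C.
    rewrite -fmorph_div/=; congr (_%:C)%C.
    by rewrite invfM mulrA divff// mul1r.
  by apply/eqP; rewrite eq_complex/= !mul0r subr0 addr0 !eqxx.
apply/eqP; rewrite eq_complex/=; apply/andP; split; apply/eqP.
  apply: intpi_punctured; first exact: continuous_ratcosM.
  by move=> t tI t0; rewrite e.
have cs : continuous (fun t => (1 : {poly R}).[cos t] / g.[cos t] * sin (t * x%:~R)).
  by move=> t; apply: cvgM; [exact: continuous_ratcos|exact: continuous_sinM].
transitivity (intpi (fun t => (1 : {poly R}).[cos t] / g.[cos t] * sin (t * x%:~R))).
  by apply: intpi_punctured => // t tI t0; rewrite e.
by apply: intpi_odd => // t; rewrite cosN mulNr sinN mulrN.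
Qed.

End PotentialKernel.

(** * Almost sure convergence by dyadic chaining *)

Section Chaining.
Context {R : realType}.
Implicit Types S F : nat -> R.

(* Dyadic majorant of [max_(n <= 2^J) (S (a + n) - S a)^2]: from level to level the
   variance is lost only by a factor 5/4, since [(x + y)^2 <= 5 x^2 + (5/4) y^2]. *)
Fixpoint chainsq S (J a : nat) : R :=
  if J is J'.+1 then
    5 * (S (a + 2 ^ J')%N - S a) ^+ 2 +
    5 / 4 * (chainsq S J' a + chainsq S J' (a + 2 ^ J')%N)
  else (S a.+1 - S a) ^+ 2.

Lemma chainsq_ge0 S J a : 0 <= chainsq S J a.
Proof.
elim: J a => [|J IH] a /=; first exact: sqr_ge0.
by apply: addr_ge0; apply: mulr_ge0; rewrite ?sqr_ge0 ?divr_ge0 ?addr_ge0 ?IH.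
Qed.

Lemma chainsq_max S J a n : (n <= 2 ^ J)%N -> (S (a + n)%N - S a) ^+ 2 <= chainsq S J a.
Proof.
elim: J a n => [|J IH] a n.
  rewrite expn0; case: n => [|[|//]] _; first by rewrite addn0 subrr expr0n sqr_ge0.
  by rewrite addn1.
move=> nJ /=; have c0 := chainsq_ge0 S J.
have d0 := sqr_ge0 (S (a + 2 ^ J)%N - S a).
have [nJ'|nJ'] := leqP n (2 ^ J).
  have h1 := IH a n nJ'; have h2 := c0 a; have h3 := c0 (a + 2 ^ J)%N.
  lra.
have : (S (a + 2 ^ J + (n - 2 ^ J))%N - S (a + 2 ^ J)%N) ^+ 2 <= chainsq S J (a + 2 ^ J)%N.
  by apply: IH; rewrite leq_subLR addnn -mul2n -expnS.
rewrite -addnA subnKC; last exact: ltnW.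
have := c0 a; move: (S (a + n)%N) (S (a + 2 ^ J)%N) (S a) => x y z.
(* With [u = y - z] and [v = x - y] this gives [2 u v <= 4 u^2 + v^2 / 4], the source of the weights
   5 and 5/4. *)
have h1 := sqr_ge0 (4 * (y - z) - (x - y)) => h2 h3.
nra.
Qed.

(** Blocks run from [4^k] to [4^(k+1)]. Splitting off the first by [(u + v)^2 <= 8 u^2 + (8/7) v^2]
    costs a factor 8/7 per later block, while the prefactor [(7/8)^J] forces the Cauchy property. *)
Lemma chainsq_blocks S J n d : (4 ^ J <= n <= 4 ^ (J + d))%N ->
  (S n - S (4 ^ J)%N) ^+ 2 <=
  8 * (7 / 8) ^+ J *
  \sum_(k < d) (8 / 7) ^+ (J + k) * chainsq S (J + k).+1.*2 (4 ^ (J + k)).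
Proof.
elim: d J => [|d IH] J.
  rewrite addn0 -eqn_leq => /eqP <-; rewrite subrr expr0n big_ord0 mulr0.
  by rewrite lexx.
move=> /andP[Jn nd]; rewrite big_ord_recl addn0.
set c := chainsq S _ _; set s := \sum_(k < d) _.
have inv : (7 / 8) ^+ J * (8 / 7) ^+ J = 1 :> R by rewrite -exprMn -[RHS](expr1n _ J); congr (_ ^+ _); field.
have c0 : 0 <= c by exact: chainsq_ge0.
have s0 : 0 <= s.
  by apply: sumr_ge0 => k _; rewrite mulr_ge0 ?exprn_ge0 ?chainsq_ge0.
have r0 : 0 <= (7 / 8) ^+ J :> R by rewrite exprn_ge0.
have rs0 : 0 <= (7 / 8) ^+ J * s by rewrite mulr_ge0.
have -> : 8 * (7 / 8) ^+ J * ((8 / 7) ^+ J * c + s) = 8 * c + 8 * ((7 / 8) ^+ J * s).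
  by rewrite mulrDr mulrA -[8 * _ * (8 / 7) ^+ J]mulrA inv; ring.
have block m : (4 ^ J <= m <= 4 ^ J.+1)%N -> (S m - S (4 ^ J)%N) ^+ 2 <= c.
  move=> /andP[Jm mJ]; rewrite -(subnKC Jm); apply: chainsq_max.
  by rewrite -mul2n expnM leq_subLR (leq_trans mJ)// leq_addl.
have [nJ|nJ] := leqP n (4 ^ J.+1).
  by have := block n; rewrite Jn nJ => /(_ isT); lra.
have := IH J.+1; rewrite ltnW//= addSnnS nd => /(_ isT).
have -> : \sum_(k < d) (8 / 7) ^+ (J.+1 + k) * chainsq S (J.+1 + k).+1.*2 (4 ^ (J.+1 + k)) = s.
  by apply: eq_bigr => k _; rewrite lift0 addSnnS.
rewrite [(7 / 8) ^+ J.+1]exprS.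
have : (S (4 ^ J.+1)%N - S (4 ^ J)%N) ^+ 2 <= c.
  by apply: block; rewrite leqnn andbT leq_pexp2l.
move: (S n) (S (4 ^ J.+1)%N) (S (4 ^ J)%N) => x y z.
have h1 := sqr_ge0 (7 * (y - z) - (x - y)).
have -> : 8 * (7 / 8 * (7 / 8) ^+ J) * s = 7 * ((7 / 8) ^+ J * s) by field.
move: rs0; move: (_ * s) => u u0 h2 h3.
by nra.
Qed.

End Chaining.

(** * Integrable majorant for sums with orthogonal increments *)

Section ChainingExpectation.
Context d {T : measurableType d} {R : realType} (P : probability T R).
Variables (S : nat -> T -> R) (F : nat -> R).
Hypothesis mS : forall n, measurable_fun setT (S n).
Hypothesis SF : forall a b, (a <= b)%N ->
  (\int[P]_w ((S b w - S a w) ^+ 2)%:E = (F b - F a)%:E)%E.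

Lemma measurable_sqdiff a b : measurable_fun setT (fun w => (S b w - S a w) ^+ 2).
Proof. by apply: measurable_funX; exact: measurable_funB. Qed.

Lemma measurable_chainsq J a : measurable_fun setT (fun w => chainsq (S ^~ w) J a).
Proof.
elim: J a => [|J IH] a /=; first exact: measurable_sqdiff.
apply: measurable_funD; apply: measurable_funM => //; first exact: measurable_sqdiff.
exact: measurable_funD.
Qed.

Lemma variance_mono a b : (a <= b)%N -> F a <= F b.
Proof.
move=> ab; rewrite -subr_ge0 -lee_fin -SF//; apply: integral_ge0 => w _.
by rewrite lee_fin sqr_ge0.
Qed.

(** The constant solves [c_0 = 1], [c_(J+1) = 5 + (5/4) c_J]; additivity of the increments of [F]
    joins the two halves. *)
Lemma expectation_chainsq J a :
  (\int[P]_w (chainsq (S ^~ w) J a)%:E <=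
   ((21 * (5 / 4) ^+ J - 20) * (F (a + 2 ^ J)%N - F a))%:E)%E.
Proof.
elim: J a => [|J IH] a /=.
  by rewrite SF// lee_fin expn0 addn1 expr0; lra.
set b := (a + 2 ^ J)%N.
have e1 : (\int[P]_w (5 * (S b w - S a w) ^+ 2 + 5 / 4 *
    (chainsq (S^~ w) J a + chainsq (S^~ w) J b))%:E =
   5%:E * \int[P]_w ((S b w - S a w) ^+ 2)%:E + (5 / 4)%:E *
    (\int[P]_w (chainsq (S^~ w) J a)%:E + \int[P]_w (chainsq (S^~ w) J b)%:E))%E.
  under eq_integral do rewrite EFinD EFinM (EFinM (5 / 4)) (EFinD (chainsq _ _ _)).
  have m1 := measurable_sqdiff a b.
  have m2 := measurable_chainsq J a; have m3 := measurable_chainsq J b.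
  rewrite ge0_integralD//; last 4 first.
  - by move=> w _; rewrite -EFinM lee_fin mulr_ge0 ?sqr_ge0.
  - by apply: measurable_funeM; exact/measurable_EFinP.
  - move=> w _; apply: mule_ge0; first by rewrite lee_fin divr_ge0.
    by apply: adde_ge0; rewrite lee_fin chainsq_ge0.
  - apply: measurable_funeM; apply: emeasurable_funD; exact/measurable_EFinP.
  rewrite ge0_integralZl_EFin//; last 2 first.
  - by move=> w _; rewrite lee_fin sqr_ge0.
  - exact/measurable_EFinP.
  rewrite ge0_integralZl_EFin//; last 2 first.
  - by move=> w _; apply: adde_ge0; rewrite lee_fin chainsq_ge0.
  - by apply: emeasurable_funD; exact/measurable_EFinP.
  rewrite ge0_integralD//.
  - by move=> w _; rewrite lee_fin chainsq_ge0.
  - exact/measurable_EFinP.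
  - by move=> w _; rewrite lee_fin chainsq_ge0.
  - exact/measurable_EFinP.
rewrite e1 SF; last exact: leq_addr.
have := leeD (IH a) (IH b).
rewrite -/b (_ : b + 2 ^ J = a + 2 ^ J.+1)%N; last by rewrite /b -addnA addnn -mul2n -expnS.
set c := (a + 2 ^ J.+1)%N => h.
pose c1 := (21 * (5 / 4) ^+ J - 20) * (F b - F a).
pose c2 := (21 * (5 / 4) ^+ J - 20) * (F c - F b).
apply: (@le_trans _ _ (5 * (F b - F a) + 5 / 4 * (c1 + c2))%:E).
  rewrite (EFinD (5 * _)) !EFinM (EFinD c1) leeD2l// lee_wpmul2l//.
rewrite /c1 /c2 lee_fin [(5 / 4) ^+ J.+1]exprS.
have Fab : F a <= F b by apply: variance_mono; exact: leq_addr.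
have Fbc : F b <= F c by apply: variance_mono; rewrite /b /c leq_add2l leq_pexp2l.
move: ((5 / 4) ^+ J) => r; move: (F a) (F b) (F c) Fab Fbc => x y z xy yz.
by nra.
Qed.

Variable K : R.
Hypothesis FK : forall J n, (4 ^ J <= n)%N -> F n - F (4 ^ J)%N <= K * (2 ^+ J)^-1.

Definition chain_bound (w : T) : \bar R :=
  (\sum_(0 <= J <oo) ((8 / 7) ^+ J * chainsq (S ^~ w) J.+1.*2 (4 ^ J))%:E)%E.

Lemma chain_term_ge0 w J :
  (0 <= ((8 / 7) ^+ J * chainsq (S ^~ w) J.+1.*2 (4 ^ J))%:E)%E.
Proof. by rewrite lee_fin mulr_ge0 ?exprn_ge0 ?chainsq_ge0. Qed.

Lemma chain_bound_ge0 w : (0 <= chain_bound w)%E.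
Proof. by apply: nneseries_ge0 => J _ _; exact: chain_term_ge0. Qed.

Lemma measurable_chain_term J : measurable_fun setT
  (fun w => ((8 / 7) ^+ J * chainsq (S ^~ w) J.+1.*2 (4 ^ J))%:E).
Proof.
apply/measurable_EFinP; apply: measurable_funM => //.
exact: measurable_chainsq.
Qed.

Lemma measurable_chain_bound : measurable_fun setT chain_bound.
Proof.
apply: ge0_emeasurable_sum => [J w _ _|J _]; first exact: chain_term_ge0.
exact: measurable_chain_term.
Qed.

(** Block [J] contributes weight [(8/7)^J], chaining loss of order [(25/16)^J] and variance
    [K 2^-J], a geometric series of ratio 25/28. *)
Lemma integral_chain_bound : (\int[P]_w chain_bound w < +oo)%E.
Proof.
have K0 : 0 <= K.
  have := @FK 0 _ (leqnn _); rewrite subrr expr0 invr1 mulr1; exact.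
rewrite integral_nneseries//; last 2 first.
- exact: measurable_chain_term.
- by move=> J w _; exact: chain_term_ge0.
pose C : R := 21 * (5 / 4) ^+ 2 * K.
have C0 : 0 <= C by rewrite !mulr_ge0// exprn_ge0.
apply: (@le_lt_trans _ _ (\sum_(0 <= J <oo) (C * (25 / 28) ^+ J)%:E)%E).
  apply: lee_nneseries => [J _ _|J _].
    by apply: integral_ge0 => w _; exact: chain_term_ge0.
  under eq_integral do rewrite EFinM.
  rewrite ge0_integralZl_EFin ?exprn_ge0//; last 2 first.
  - by move=> w _; rewrite lee_fin chainsq_ge0.
  - by apply/measurable_EFinP; exact: measurable_chainsq.
  apply: (@le_trans _ _ (((8 / 7) ^+ J)%:E *
      ((21 * (5 / 4) ^+ J.+1.*2 - 20) * (F (4 ^ J + 2 ^ J.+1.*2)%N - F (4 ^ J)%N))%:E)%E).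
    by rewrite lee_wpmul2l ?lee_fin ?exprn_ge0// expectation_chainsq.
  rewrite -EFinM lee_fin.
  have F1 : F (4 ^ J + 2 ^ J.+1.*2)%N - F (4 ^ J)%N <= K * (2 ^+ J)^-1.
    by apply: FK; exact: leq_addr.
  have F0 : 0 <= F (4 ^ J + 2 ^ J.+1.*2)%N - F (4 ^ J)%N.
    by rewrite subr_ge0 variance_mono// leq_addr.
  have e1 : (5 / 4) ^+ J.+1.*2 = (5 / 4) ^+ 2 * (25 / 16) ^+ J :> R.
    by rewrite -mul2n exprM exprS; congr (_ * _ ^+ _); field.
  have e2 : (8 / 7) ^+ J * ((25 / 16) ^+ J * (2 ^+ J)^-1) = (25 / 28) ^+ J :> R.
    by rewrite -exprVn -!exprMn; congr (_ ^+ _); field.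
  apply: (@le_trans _ _ ((8 / 7) ^+ J * (21 * (5 / 4) ^+ J.+1.*2 * (K * (2 ^+ J)^-1)))).
    rewrite ler_wpM2l ?exprn_ge0//.
    apply: (@le_trans _ _ (21 * (5 / 4) ^+ J.+1.*2 * (F (4 ^ J + 2 ^ J.+1.*2)%N - F (4 ^ J)%N))).
      by rewrite ler_wpM2r//; lra.
    by rewrite ler_wpM2l// mulr_ge0// exprn_ge0.
  rewrite e1 -e2 /C le_eqVlt; apply/orP; left; apply/eqP.
  by move: (_ ^+ J) (_ ^+ J) (_^-1) => x y z; ring.
have gs : cvgn (series (geometric C (25 / 28 : R))).
  by apply: is_cvg_geometric_series; rewrite ger0_norm//; lra.
rewrite (_ : (\sum_(0 <= J <oo) (C * (25 / 28) ^+ J)%:E)%E =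
  (limn (series (geometric C (25 / 28 : R))))%:E) ?ltry//.
rewrite -EFin_lim//; congr (limn _); apply/funext => n /=.
by rewrite /series/= sumEFin.
Qed.

Lemma chain_bound_sqdiff w J n : (chain_bound w < +oo)%E -> (4 ^ J <= n)%N ->
  (S n w - S (4 ^ J)%N w) ^+ 2 <= 8 * (7 / 8) ^+ J * fine (chain_bound w).
Proof.
move=> Hw Jn.
(* From [n < 4 ^ n], taking [n] further blocks is enough to reach [n]. *)
have nd : (4 ^ J <= n <= 4 ^ (J + n))%N.
  by rewrite Jn/=; apply: (leq_trans (ltnW (ltn_expl n (isT : 1 < 4)%N))); rewrite leq_pexp2l// leq_addl.
apply: le_trans (chainsq_blocks (S ^~ w) nd) _.
rewrite ler_wpM2l ?mulr_ge0 ?exprn_ge0//.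
have Hfin : chain_bound w \is a fin_num by rewrite ge0_fin_numE ?chain_bound_ge0.
rewrite -lee_fin fineK// -sumEFin.
apply: le_trans (@nneseries_lim_ge _ _ xpredT 0 (J + n) (fun k _ _ => chain_term_ge0 w k)).
rewrite (@big_cat_nat _ _ _ J)//= ?leq_addr//.
rewrite -[leLHS]add0e; apply: leeD; first by apply: sume_ge0 => k _; exact: chain_term_ge0.
rewrite -[X in (_ <= \sum_(X <= _ < _) _)%E]add0n big_addn addKn big_mkord.
by under [leRHS]eq_bigr do rewrite addnC.
Qed.

Lemma chain_bound_cvg w : (chain_bound w < +oo)%E -> cvgn (S ^~ w).
Proof.
move=> Hw; apply: cauchy_cvg; apply: cauchy_exP => e e0.
set H := fine (chain_bound w).
have H0 : 0 <= H by rewrite fine_ge0// chain_bound_ge0.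
have : 8 * H * (7 / 8) ^+ J @[J --> \oo] --> 8 * H * 0.
  by apply: cvgMl_tmp; apply: cvg_expr; rewrite ger0_norm//; lra.
rewrite mulr0 => /cvgr0Pnorm_lt /(_ (e ^+ 2) (exprn_gt0 _ e0)) [J _ /(_ J (leqnn J))/= hJ].
exists (S (4 ^ J)%N w); exists (4 ^ J)%N => // n /= Jn.
rewrite /ball/= distrC -ltr_sqr ?nnegrE ?(ltW e0)// real_normK ?num_real//.
apply: le_lt_trans (chain_bound_sqdiff Hw Jn) _.
by apply: le_lt_trans hJ; rewrite mulrAC ler_norm.
Qed.

End ChainingExpectation.

(** * Measurability of pointwise limits *)

Section MeasurableLimit.
Context d {T : measurableType d} {R : realType} (S : nat -> T -> R).
Hypothesis mS : forall n, measurable_fun setT (S n).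

(** The Cauchy criterion, written with countable unions and intersections only. *)
Lemma measurable_cvgn : measurable [set w | cvgn (S ^~ w)].
Proof.
rewrite (_ : [set w | _] = \bigcap_(k in [set: nat]) \bigcup_(N in [set: nat])
    \bigcap_(n in [set: nat]) [set w | `|S (N + n)%N w - S N w| <= k.+1%:R^-1]).
  apply: bigcapT_measurable => k; apply: bigcupT_measurable => N.
  apply: bigcapT_measurable => n.
  have -> : [set w | `|S (N + n)%N w - S N w| <= k.+1%:R^-1] =
      setT `&` (fun w => `|S (N + n)%N w - S N w|) @^-1` [set` `]-oo, (k.+1%:R^-1 : R)]].
    by apply/seteqP; split => w /=; rewrite in_itv/= => // -[].
  suff : measurable_fun setT (fun w => `|S (N + n)%N w - S N w|) by apply.
  by apply: measurableT_comp => //; exact: measurable_funB.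
apply/seteqP; split => [w /= cw k _|w /= hw].
  have k0 : 0 < k.+1%:R^-1 / 2 :> R by rewrite divr_gt0.
  have /cvgrPdist_lt /(_ _ k0) [N _ hN] := cw.
  exists N => // n _ /=.
  have h1 := hN (N + n)%N (leq_addr n N); have h2 := hN N (leqnn N).
  move: h1 h2 => /=; set l := lim _; rewrite distrC => h1 h2.
  have := ler_distD l (S (N + n)%N w) (S N w) => h3.
  by apply: (le_trans h3); rewrite [leRHS]splitr ltW// ltrD.
apply: cauchy_cvg; apply: cauchy_exP => e e0.
have [k ke] : exists k, k.+1%:R^-1 < e.
  exists (Num.bound e^-1); rewrite invf_plt ?posrE//.
  have : e^-1 < (Num.bound e^-1)%:R by apply: archi_boundP; rewrite invr_ge0 ltW.
  by move=> /lt_le_trans; apply; rewrite ler_nat.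
have [N _ hN] := hw k I.
exists (S N w); exists N => // n /= Nn; rewrite /ball/= distrC.
by have := hN (n - N)%N I => /=; rewrite subnKC// => /le_lt_trans; exact.
Qed.

(** Where the sequence diverges, [limn] returns the default [point]. Replacing the sequence by that
    constant there makes it converge everywhere to [limn]. *)
Lemma measurable_limn : measurable_fun setT (fun w => limn (S ^~ w)).
Proof.
set C := [set w | cvgn (S ^~ w)].
have mC : measurable_fun setT (\1_C : T -> R).
  by apply: measurable_indic; exact: measurable_cvgn.
apply: (@measurable_fun_cvg _ _ _ _
  (fun n w => S n w * \1_C w + (point : R) * (1 - \1_C w))) => [n|w _].
  apply: measurable_funD; apply: measurable_funM => //.
  exact: measurable_funB.
have [wC|wC] := pselect (C w).
  rewrite indicE mem_set//=.
  under eq_fun do rewrite mulr1 subrr mulr0 addr0.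
  exact: wC.
rewrite indicE memNset//= (dvgP wC).
under eq_fun do rewrite mulr0 add0r subr0 mulr1.
exact: cvg_cst.
Qed.

End MeasurableLimit.

(** * Expectation of a product of two limits *)

Section LimitProduct.
Context d {T : measurableType d} {R : realType} (P : probability T R).

Lemma chain_lim_mul (S S' : nat -> T -> R) (F F' e : nat -> R) (K K' l : R) :
  (forall n, measurable_fun setT (S n)) -> (forall n, measurable_fun setT (S' n)) ->
  (forall w, S 0%N w = 0) -> (forall w, S' 0%N w = 0) ->
  (forall a b, (a <= b)%N ->
    (\int[P]_w ((S b w - S a w) ^+ 2)%:E = (F b - F a)%:E)%E) ->
  (forall a b, (a <= b)%N ->
    (\int[P]_w ((S' b w - S' a w) ^+ 2)%:E = (F' b - F' a)%:E)%E) ->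
  (forall J n, (4 ^ J <= n)%N -> F n - F (4 ^ J)%N <= K * (2 ^+ J)^-1) ->
  (forall J n, (4 ^ J <= n)%N -> F' n - F' (4 ^ J)%N <= K' * (2 ^+ J)^-1) ->
  (forall n, (\int[P]_w (S n w * S' n w)%:E = (e n)%:E)%E) ->
  e n @[n --> \oo] --> l ->
  (\int[P]_w (limn (S ^~ w) * limn (S' ^~ w))%:E = l%:E)%E.
Proof.
move=> mS mS' S0 S0' SF SF' FK FK' Se el.
pose H := chain_bound S; pose H' := chain_bound S'.
have H0 w : (0 <= H w)%E by exact: chain_bound_ge0.
have H0' w : (0 <= H' w)%E by exact: chain_bound_ge0.
have mH : measurable_fun setT H by exact: measurable_chain_bound.
have mH' : measurable_fun setT H' by exact: measurable_chain_bound.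
have intH (G : T -> \bar R) : (forall w, 0 <= G w)%E -> measurable_fun setT G ->
    (\int[P]_w G w < +oo)%E -> P.-integrable setT G.
  move=> G0 mG iG; apply/integrableP; split => //.
  by under eq_integral do rewrite gee0_abs//.
have iH : P.-integrable setT H.
  by apply: intH => //; exact: (integral_chain_bound mS SF FK).
have iH' : P.-integrable setT H'.
  by apply: intH => //; exact: (integral_chain_bound mS' SF' FK').
have int1 (s : nat -> T -> R) (f : nat -> R) : (forall n, measurable_fun setT (s n)) ->
    (forall w, s 0%N w = 0) -> (forall a b, (a <= b)%N ->
    (\int[P]_w ((s b w - s a w) ^+ 2)%:E = (f b - f a)%:E)%E) ->
    P.-integrable setT (fun w => (s 1%N w ^+ 2)%:E).
  move=> ms s0 sf; apply: intH => [w||].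
  - by rewrite lee_fin sqr_ge0.
  - by apply/measurable_EFinP; exact: measurable_funX.
  - have := sf 0%N 1%N isT; under eq_integral do rewrite s0 subr0.
    by move=> ->; rewrite ltry.
(* Dominates [|x y| <= (x^2 + y^2) / 2], with [x^2 <= 2 x_1^2 + 2 (x - x_1)^2] and the block bound
   at [J = 0]. Its base time is [4^0 = 1], hence the indices [n.+1] below. *)
pose g w : \bar R := ((S 1%N w ^+ 2)%:E + (S' 1%N w ^+ 2)%:E + (8%:E * H w + 8%:E * H' w))%E.
have ig : P.-integrable setT g.
  apply: integrableD => //; apply: integrableD => //.
  - exact: int1 SF.
  - exact: int1 SF'.
  - exact: integrableZl.
  - exact: integrableZl.
have m1 n : measurable_fun setT (fun w => (S n.+1 w * S' n.+1 w)%:E).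
  by apply/measurable_EFinP; exact: measurable_funM.
have m2 : measurable_fun setT (fun w => (limn (S ^~ w) * limn (S' ^~ w))%:E).
  by apply/measurable_EFinP; apply: measurable_funM; exact: measurable_limn.
have aeH := integrable_ae measurableT iH; have aeH' := integrable_ae measurableT iH'.
have ae1 : {ae P, forall w, setT w -> (S n.+1 w * S' n.+1 w)%:E @[n --> \oo] -->
    (limn (S ^~ w) * limn (S' ^~ w))%:E}.
  apply: filterS2 aeH aeH' => w /(_ I) hw /(_ I) hw' _.
  apply: cvg_EFin; first by near=> n.
  rewrite (_ : fine \o _ = (fun n => S n.+1 w * S' n.+1 w))//.
  have cS : S n.+1 w @[n --> \oo] --> limn (S ^~ w).
    rewrite (cvg_shiftS (S ^~ w)); apply: chain_bound_cvg.
    by rewrite -ge0_fin_numE.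
  have cS' : S' n.+1 w @[n --> \oo] --> limn (S' ^~ w).
    rewrite (cvg_shiftS (S' ^~ w)); apply: chain_bound_cvg.
    by rewrite -ge0_fin_numE.
  exact: cvgM.
have ae2 : {ae P, forall w n, setT w -> (`|(S n.+1 w * S' n.+1 w)%:E| <= g w)%E}.
  apply: filterS2 aeH aeH' => w /(_ I) hw /(_ I) hw' n _.
  have b := @chain_bound_sqdiff _ _ _ S w 0 n.+1 _ isT.
  have b' := @chain_bound_sqdiff _ _ _ S' w 0 n.+1 _ isT.
  move: b b'; rewrite -!ge0_fin_numE// => /(_ hw) b /(_ hw') b'.
  rewrite /g -(fineK hw) -(fineK hw') -!EFinM -!EFinD /= lee_fin.
  move: b b'; rewrite expn0 expr0 mulr1 -/(H w) -/(H' w).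
  move: (fine (H w)) (fine (H' w)) (S n.+1 w) (S' n.+1 w) (S 1%N w) (S' 1%N w).
  move=> h h' x y x1 y1 b b'.
  have u1 := sqr_ge0 (x - 2 * x1); have u2 := sqr_ge0 (y - 2 * y1).
  have u3 := sqr_ge0 (x - y); have u4 := sqr_ge0 (x + y).
  by rewrite ler_norml; apply/andP; split; nra.
have [_ _ lim1] := dominated_convergence measurableT m1 m2 ae1 ig ae2.
have lim2 : (\int[P]_w (S n.+1 w * S' n.+1 w)%:E)%E @[n --> \oo] --> l%:E.
  under eq_fun do rewrite Se.
  apply: cvg_EFin; first by near=> n.
  by rewrite (_ : fine \o _ = (fun n => e n.+1))// (cvg_shiftS e).
exact: (cvg_unique _ lim1 lim2).
Unshelve. all: by end_near. Qed.

End LimitProduct.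

(** * Means, bilinearity and products of independent variables *)

Section MeanValue.
Context d {T : measurableType d} {R : realType} (P : probability T R).

Definition has_mean (f : T -> R) (v : R) :=
  P.-integrable setT (EFin \o f) /\ (\int[P]_w (f w)%:E = v%:E)%E.

Lemma has_mean0 : has_mean (fun=> 0) 0.
Proof. by split; [exact: integrable0|exact: integral0]. Qed.

Lemma has_meanD f g u v : has_mean f u -> has_mean g v ->
  has_mean (fun w => f w + g w) (u + v).
Proof.
move=> [fi fu] [gi gv]; split; first exact: (integrableD measurableT fi gi).
by have := integralD_EFin measurableT fi gi; rewrite fu gv EFinD.
Qed.

Lemma has_meanZ (c : R) f u : has_mean f u -> has_mean (fun w => c * f w) (c * u).
Proof.
move=> [fi fu]; split; first exact: (integrableZl measurableT c fi).
by have := integralZl measurableT fi c; rewrite fu EFinM.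
Qed.

Lemma has_mean_sum (I : Type) (r : seq I) (f : I -> T -> R) (v : I -> R) :
  (forall k, has_mean (f k) (v k)) ->
  has_mean (fun w => \sum_(k <- r) f k w) (\sum_(k <- r) v k).
Proof.
move=> fv; elim: r => [|k r IH].
  by under eq_fun do rewrite big_nil; rewrite big_nil; exact: has_mean0.
by under eq_fun do rewrite big_cons; rewrite big_cons; exact: has_meanD.
Qed.

Lemma has_mean_sum2 (I J : Type) (r : seq I) (s : seq J) (X : I -> T -> R)
    (Y : J -> T -> R) (v : I -> J -> R) :
  (forall k l, has_mean (fun w => X k w * Y l w) (v k l)) ->
  has_mean (fun w => (\sum_(k <- r) X k w) * (\sum_(l <- s) Y l w))
           (\sum_(k <- r) \sum_(l <- s) v k l).
Proof.
move=> XY; under eq_fun do rewrite mulr_suml; apply: has_mean_sum => k.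
by under eq_fun do rewrite mulr_sumr; exact: has_mean_sum.
Qed.

Lemma sqr_integrable_mul (X Y : T -> R) :
  measurable_fun setT X -> measurable_fun setT Y ->
  P.-integrable setT (fun w => (X w ^+ 2)%:E) ->
  P.-integrable setT (fun w => (Y w ^+ 2)%:E) ->
  P.-integrable setT (fun w => (X w * Y w)%:E).
Proof.
move=> mX mY iX iY.
apply: (le_integrable measurableT _ _ (integrableD measurableT iX iY)).
  by apply/measurable_EFinP; exact: measurable_funM.
move=> w _ /=; rewrite lee_fin [leRHS]ger0_norm ?addr_ge0 ?sqr_ge0//.
have u3 := sqr_ge0 (X w - Y w); have u4 := sqr_ge0 (X w + Y w).
have u1 := sqr_ge0 (X w); have u2 := sqr_ge0 (Y w).
by rewrite ler_norml; apply/andP; split; nra.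
Qed.

(** Factorization on rectangles identifies the joint law with the product of the marginal laws;
    Fubini then splits the integral. *)
Lemma integral_mul_indep (X Y : T -> R) :
  measurable_fun setT X -> measurable_fun setT Y ->
  (forall A B, measurable A -> measurable B ->
    P (X @^-1` A `&` Y @^-1` B) = (P (X @^-1` A) * P (Y @^-1` B))%E) ->
  P.-integrable setT (EFin \o X) -> P.-integrable setT (EFin \o Y) ->
  P.-integrable setT (fun w => (X w * Y w)%:E) ->
  (\int[P]_w (X w * Y w)%:E = (\int[P]_w (X w)%:E) * (\int[P]_w (Y w)%:E))%E.
Proof.
move=> mX mY XY iX iY iXY.
pose X' : {RV P >-> R} := HB.pack_for {mfun T >-> R} X (isMeasurableFun.Build _ _ _ _ X mX).
pose Y' : {RV P >-> R} := HB.pack_for {mfun T >-> R} Y (isMeasurableFun.Build _ _ _ _ Y mY).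
have mZ : measurable_fun setT (fun w => (X w, Y w)) by exact: measurable_fun_pair.
pose Z' : {RV P >-> (R * R)%type} := HB.pack_for {mfun T >-> (R * R)%type}
  (fun w => (X w, Y w)) (isMeasurableFun.Build _ _ _ _ (fun w => (X w, Y w)) mZ).
pose f (z : R * R) : \bar R := (z.1 * z.2)%:E.
have mf : measurable_fun setT f.
  apply/measurable_EFinP; apply: measurable_funM.
    exact: measurable_fst.
  exact: measurable_snd.
have law A : measurable A -> (distribution P X' \x distribution P Y')%E A = distribution P Z' A.
  apply: product_measure_unique => B C mB mC; rewrite -[RHS]XY//.
have e1 : (\int[P]_w (X w * Y w)%:E = \int[distribution P X' \x distribution P Y']_z f z)%E.
  rewrite -[LHS](@integral_distribution _ _ _ _ _ P Z' f mf iXY).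
  by apply: eq_measure_integral => A mA _; apply/esym/law.
have if12 : (distribution P X' \x distribution P Y')%E.-integrable setT f.
  apply/integrableP; split => //.
  rewrite (@eq_measure_integral _ _ _ _ (distribution P Z')) => [|A mA _]; last exact: law.
  rewrite (@ge0_integral_distribution _ _ _ _ _ P Z' (fun z => `|f z|%E))//.
    by case/integrableP : iXY.
  exact: measurableT_comp.
have iid (W : {RV P >-> R}) : P.-integrable setT (EFin \o W) ->
    (distribution P W).-integrable setT (EFin \o id).
  move=> iW; apply/integrableP; split; first exact/measurable_EFinP.
  rewrite (@ge0_integral_distribution _ _ _ _ _ P W (fun x => `|x%:E|%E))//.
    by case/integrableP : iW.
  by apply: measurableT_comp => //; exact/measurable_EFinP.
have mean (W : {RV P >-> R}) : P.-integrable setT (EFin \o W) ->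
    (\int[distribution P W]_x x%:E = \int[P]_w (W w)%:E)%E.
  by move=> iW; rewrite (@integral_distribution _ _ _ _ _ P W EFin)//; exact/measurable_EFinP.
rewrite e1 -integral12_prod_meas1//.
rewrite -(mean X' iX) -(mean Y' iY).
have finY : (\int[distribution P Y']_y y%:E)%E \is a fin_num.
  exact: (integrable_fin_num measurableT (iid Y' iY)).
rewrite -(fineK finY) -(integralZr measurableT (iid X' iX)).
apply: eq_integral => x _; rewrite /fubini_F /f/= (fineK finY).
by rewrite -(integralZl measurableT (iid Y' iY)).
Qed.

End MeanValue.

(** * Space-time white noise *)

Lemma sum_diag {R : nzSemiRingType} (I : eqType) (r : seq I) (f : I -> I -> R) :
  uniq r ->
  \sum_(k <- r) \sum_(l <- r) (k == l)%:R * f k l = \sum_(k <- r) f k k.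
Proof.
move=> ur; apply: eq_big_seq => k kr.
rewrite (bigD1_seq k)//= eqxx mul1r big1 ?addr0// => l.
by rewrite eq_sym => /negPf ->; rewrite mul0r.
Qed.

Section Noise.
Context d {T : measurableType d} {R : realType} (P : probability T R).
Variable xi : int -> int -> T -> R.
Hypothesis xi_meas : forall t x, measurable_fun setT (xi t x).
Hypothesis xi_indep : mutually_independent P (fun tx : int * int => xi tx.1 tx.2).
Hypothesis xi_id : forall t x B, measurable B ->
  P (xi t x @^-1` B) = P (xi 0 0 @^-1` B).
Hypothesis xi_mean0 : forall t x, ('E_P[xi t x] = 0)%E.
Hypothesis xi_var : ('E_P[fun w => (xi 0 0 w ^+ 2)%R] < +oo)%E.
Local Notation s2 := (fine 'V_P[xi 0 0]).

Lemma noise_sqr_mean t x : has_mean P (fun w => xi t x w ^+ 2) s2.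
Proof.
have sqr_id : (\int[P]_w (xi t x w ^+ 2)%:E = \int[P]_w (xi 0 0 w ^+ 2)%:E)%E.
  pose W y z : {RV P >-> R} := HB.pack_for {mfun T >-> R} (xi y z)
    (isMeasurableFun.Build _ _ _ _ (xi y z) (xi_meas y z)).
  have e y z : (\int[P]_w (xi y z w ^+ 2)%:E =
      \int[distribution P (W y z)]_u (u ^+ 2)%:E)%E.
    rewrite (@ge0_integral_distribution _ _ _ _ _ P (W y z) (fun u => (u ^+ 2)%:E))//.
      by apply/measurable_EFinP; exact: exprn_measurable.
    by move=> u; rewrite lee_fin sqr_ge0.
  rewrite !e; apply: eq_measure_integral => A mA _; exact: xi_id.
have fin0 : (\int[P]_w (xi 0 0 w ^+ 2)%:E)%E \is a fin_num.
  rewrite ge0_fin_numE; first by move: xi_var; rewrite unlock.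
  by apply: integral_ge0 => w _; rewrite lee_fin sqr_ge0.
have s2E : (\int[P]_w (xi 0 0 w ^+ 2)%:E)%E = s2%:E.
  rewrite -(fineK fin0); congr (fine _)%:E.
  rewrite /variance unlock xi_mean0/= unlock; apply: eq_integral => w _.
  rewrite -[RHS]/((xi 0 0 w - 0) * (xi 0 0 w - 0))%:E.
  by rewrite subr0 -expr2.
split; last by rewrite sqr_id.
apply/integrableP; split.
  by apply/measurable_EFinP; exact: measurable_funX.
under eq_integral do rewrite gee0_abs ?lee_fin ?sqr_ge0//.
by rewrite sqr_id -ge0_fin_numE// integral_ge0// => w _; rewrite lee_fin sqr_ge0.
Qed.

Lemma noise_integrable t x : P.-integrable setT (EFin \o xi t x).
Proof.
have [i2 _] := noise_sqr_mean t x.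
have i1 : P.-integrable setT (EFin \o (fun=> 1 : R)).
  exact: (finite_measure_integrable_cst P 1).
apply: (le_integrable measurableT _ _ (integrableD measurableT i1 i2)).
  exact/measurable_EFinP.
move=> w _ /=; rewrite lee_fin [leRHS]ger0_norm ?addr_ge0 ?sqr_ge0//.
have u3 := sqr_ge0 (xi t x w - 1); have u4 := sqr_ge0 (xi t x w + 1).
by rewrite ler_norml; apply/andP; split; nra.
Qed.

Lemma noise_cov (i j : int * int) :
  has_mean P (fun w => xi i.1 i.2 w * xi j.1 j.2 w) ((i == j)%:R * s2).
Proof.
have [<-|ij] := eqVneq i j.
  by rewrite mul1r; under eq_fun do rewrite -expr2; exact: noise_sqr_mean.
have iij : P.-integrable setT (fun w => (xi i.1 i.2 w * xi j.1 j.2 w)%:E).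
  apply: sqr_integrable_mul => //.
  - by have [] := noise_sqr_mean i.1 i.2.
  - by have [] := noise_sqr_mean j.1 j.2.
split => //; rewrite mul0r integral_mul_indep//; try exact: noise_integrable.
  by have := xi_mean0 i.1 i.2; rewrite unlock => ->; rewrite mul0e.
move=> A B mA mB.
(* On a two-point family, joint independence is the rectangle condition for the pair. *)
have := xi_indep (s := [:: i; j]) (B := fun k => if k == i then A else B).
rewrite !big_cons big_nil /= !eqxx [j == i]eq_sym (negPf ij) mulr1 inE ij.
move=> /(_ isT) h; rewrite EFinM !fineK ?fin_num_measure// in h.
- rewrite -h.
    congr (P _); apply/seteqP; split => [w [/= hA hB] k|w /= h'].
      by rewrite !inE => /orP[] /eqP ->; rewrite ?eqxx// eq_sym (negPf ij).
    split; first by have := h' i; rewrite !inE !eqxx; exact.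
    by have := h' j; rewrite !inE eqxx orbT eq_sym (negPf ij); exact.
  by move=> k; case: ifP.
- by rewrite -[X in measurable X]setTI; exact: xi_meas.
- by rewrite -[X in measurable X]setTI; exact: xi_meas.
Qed.

(** * Orthogonality and covariance of the increments *)

Section Increments.
Variables (p : int -> R) (M : nat).
Hypothesis p_supp : zsupp M p.

Definition ptrans_diff k x z : R := ptrans p k x z - ptrans p k (x - 1) z.
Local Notation D := ptrans_diff.

Lemma ptrans_diff_supp k x : zsupp (k * M + `|x| + 1)%N (D k x).
Proof.
by move=> z h; rewrite /D !ptransE !(convpow_supp p_supp) ?subrr//; lia.
Qed.

(** The product expands into four overlaps of time-[k] laws: the two aligned ones give
    [2 q^k(x - y)], the two crossed ones its neighbours. *)
Lemma ptrans_diff_corr k x y :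
  zsum (fun z => D k x z * D k y z) = disc_corr p k (x - y).
Proof.
have piN : zsupp (k * M) (convpow p k) by exact: convpow_supp.
have pair a b : zsum (fun z => convpow p k (z - a) * convpow p k (z - b)) =
    convpow (autocorr p) k (a - b).
  rewrite -(autocorr_convpow _ _ p_supp) -[RHS](zsum_shift (- a)); apply: eq_zsum => z.
  by congr (_ * convpow p k _); ring.
pose B := (k * M + `|x| + `|y| + 1)%N.
have supp a b : (`|a| + k * M <= B)%N ->
    zsupp B (fun z => convpow p k (z - a) * convpow p k (z - b)).
  by move=> aB z Bz; rewrite piN ?mul0r//; lia.
have -> : (fun z => D k x z * D k y z) = (fun z =>
    convpow p k (z - x) * convpow p k (z - y) +
    convpow p k (z - (x - 1)) * convpow p k (z - (y - 1)) +
    (-1 * (convpow p k (z - x) * convpow p k (z - (y - 1))) +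
     -1 * (convpow p k (z - (x - 1)) * convpow p k (z - y)))).
  by apply/funext => z; rewrite /D !ptransE; ring.
have s1 a b : (`|a| + k * M <= B)%N ->
    zsupp B (fun z => -1 * (convpow p k (z - a) * convpow p k (z - b))).
  by move=> /supp h z Bz; rewrite h// mulr0.
have xB : (`|x| + k * M <= B)%N by rewrite /B; lia.
have x1B : (`|(x - 1)%R| + k * M <= B)%N by rewrite /B; lia.
rewrite (@zsumD _ B); first last.
- by move=> z Bz; rewrite s1// s1// addr0.
- by move=> z Bz; rewrite supp// supp// addr0.
rewrite (@zsumD _ B); [|exact: supp..].
rewrite (@zsumD _ B); [|exact: s1..].
rewrite !zsumZ !pair /disc_corr.
have -> : x - 1 - (y - 1) = x - y by ring.
have -> : x - (y - 1) = x - y + 1 by ring.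
have -> : x - 1 - y = x - y - 1 by ring.
by ring.
Qed.

Definition increment k x w : R := zsum (fun z => xi (- k%:Z) z w * D k x z).

Lemma incrementE N k x w : (k * M + `|x| + 1 <= N)%N ->
  increment k x w = \sum_(z <- zrange N) D k x z * xi (- k%:Z) z w.
Proof.
move=> hN; rewrite /increment (@zsumE _ N) => [|z Nz].
  by apply: eq_bigr => z _; rewrite mulrC.
by rewrite (@ptrans_diff_supp k x z) ?mulr0//; exact: leq_ltn_trans Nz.
Qed.

Lemma measurable_increment k x : measurable_fun setT (increment k x).
Proof.
apply: (@eq_measurable_fun _ _ _ _ setT (fun w =>
    \sum_(z <- zrange (k * M + `|x| + 1)) D k x z * xi (- k%:Z) z w)).
  by move=> w _; rewrite (@incrementE (k * M + `|x| + 1)).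
by apply: measurable_sum => z; exact: measurable_funM.
Qed.

(** Distinct [k] read the noise at distinct times, hence are uncorrelated; at equal [k] only equal
    sites survive. *)
Lemma increment_cov k l x y : has_mean P (fun w => increment k x w * increment l y w)
  ((k == l)%:R * (s2 * disc_corr p k (x - y))).
Proof.
pose N := (k * M + `|x| + 1 + (l * M + `|y| + 1))%N.
have -> : (fun w => increment k x w * increment l y w) = (fun w =>
    (\sum_(z <- zrange N) D k x z * xi (- k%:Z) z w) *
    (\sum_(z <- zrange N) D l y z * xi (- l%:Z) z w)).
  by apply/funext => w; rewrite !(@incrementE N)// /N; lia.
have -> : (k == l)%:R * (s2 * disc_corr p k (x - y)) =
    \sum_(z <- zrange N) \sum_(z' <- zrange N) D k x z * D l y z' *
      (((- k%:Z, z) == (- l%:Z, z'))%:R * s2).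
  have [<-|kl] := eqVneq k l.
    transitivity (\sum_(z <- zrange N) \sum_(z' <- zrange N)
        (z == z')%:R * (D k x z * D k y z' * s2)).
      rewrite sum_diag ?zrange_uniq// -ptrans_diff_corr mul1r mulrC.
      rewrite (@zsumE _ N) ?mulr_suml// => z Nz.
      by rewrite (@ptrans_diff_supp k x z) ?mul0r//; move: Nz; rewrite /N; lia.
    apply: eq_bigr => z _; apply: eq_bigr => z' _.
    by rewrite xpair_eqE eqxx/=; ring.
  rewrite mul0r big1// => z _; rewrite big1// => z' _.
  by rewrite xpair_eqE eqr_opp eqz_nat (negPf kl)/= mul0r mulr0.
apply: has_mean_sum2 => z z'.
have := has_meanZ (D k x z * D l y z') (noise_cov (- k%:Z, z) (- l%:Z, z')).
by congr (has_mean P _ _); apply/funext => w /=; ring.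
Qed.

Lemma Delta0_partialE x K w :
  Delta0_partial xi p x K w = \sum_(0 <= k < K) increment k x w.
Proof. by rewrite big_mkord. Qed.

Lemma increment_sum_sqr a b x :
  (\int[P]_w ((\sum_(a <= k < b) increment k x w) ^+ 2)%:E =
   (s2 * \sum_(a <= k < b) disc_corr p k 0)%:E)%E.
Proof.
have := has_mean_sum2 (index_iota a b) (index_iota a b)
  (fun k l => increment_cov k l x x).
rewrite sum_diag ?iota_uniq// subrr -mulr_sumr => -[_ <-].
by apply: eq_integral => w _; rewrite expr2.
Qed.

Lemma increment_sum_mul n x y :
  (\int[P]_w ((\sum_(0 <= k < n) increment k x w) * (\sum_(0 <= k < n) increment k y w))%:E =
   (s2 * \sum_(k < n) disc_corr p k (x - y))%:E)%E.
Proof.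
have := has_mean_sum2 (index_iota 0 n) (index_iota 0 n)
  (fun k l => increment_cov k l x y).
by rewrite sum_diag ?iota_uniq// -mulr_sumr big_mkord => -[_ <-].
Qed.

Lemma V0_lim (K l : R) x :
  (forall J n, (4 ^ J <= n)%N ->
     s2 * \sum_(4 ^ J <= k < n) disc_corr p k 0 <= K * (2 ^+ J)^-1) ->
  \sum_(k < n) disc_corr p k (- x) @[n --> \oo] --> l ->
  V0 P xi p x = s2 * l.
Proof.
move=> hK hl.
(* Accumulated variance of the partial sums; it is the same at every site because only [x - x = 0]
   enters. *)
pose F n := s2 * \sum_(0 <= k < n) disc_corr p k 0.
have FB a b : (a <= b)%N -> F b - F a = s2 * \sum_(a <= k < b) disc_corr p k 0.
  by move=> ab; rewrite /F -mulrBr; congr (_ * _); rewrite (@big_cat_nat _ _ _ a 0 b)//= addrAC subrr add0r.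
have mS y n : measurable_fun setT (Delta0_partial xi p y n).
  apply: (@eq_measurable_fun _ _ _ _ setT (fun w =>
    \sum_(0 <= k < n) increment k y w)).
    by move=> w _; rewrite Delta0_partialE.
  by apply: measurable_sum => k; exact: measurable_increment.
have S0 y w : Delta0_partial xi p y 0 w = 0 by rewrite Delta0_partialE big_geq.
have SF y a b : (a <= b)%N -> (\int[P]_w ((Delta0_partial xi p y b w -
    Delta0_partial xi p y a w) ^+ 2)%:E = (F b - F a)%:E)%E.
  move=> ab; rewrite FB// -(increment_sum_sqr a b y); apply: eq_integral => w _.
  congr (_ ^+ 2)%:E; rewrite !Delta0_partialE (@big_cat_nat _ _ _ a 0 b)//=.
  by rewrite addrAC subrr add0r.
have FK J n : (4 ^ J <= n)%N -> F n - F (4 ^ J)%N <= K * (2 ^+ J)^-1.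
  by move=> Jn; rewrite FB//; exact: hK.
have lim : s2 * \sum_(k < n) disc_corr p k (0 - x) @[n --> \oo] --> s2 * l.
  by under eq_fun do rewrite sub0r; exact: cvgMl_tmp.
rewrite /V0 unlock.
have -> : (\int[P]_w (Delta0 xi p 0 w * Delta0 xi p x w)%:E = (s2 * l)%:E)%E.
  apply: (chain_lim_mul (mS 0) (mS x) (S0 0) (S0 x) (SF 0) (SF x) FK FK _ lim).
  move=> n; rewrite -increment_sum_mul; apply: eq_integral => w _.
  by rewrite !Delta0_partialE.
by [].
Qed.

End Increments.
End Noise.

(** * From the Fourier representation to the theorem *)

Lemma zsupp_of_norm {R : realType} (p : int -> R) (M : nat) :
  (forall x : int, (M%:Z < `|x|)%R -> p x = 0) -> zsupp M p.
Proof. by move=> h x Mx; apply: h; rewrite -abszE ltz_nat. Qed.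

Lemma V0_ratfourier d {T : measurableType d} {R : realType} (P : probability T R)
  (xi : int -> int -> T -> R) (p : int -> R) (M : nat) (g : {poly R}) :
  (forall t x, measurable_fun setT (xi t x)) ->
  mutually_independent P (fun tx : int * int => xi tx.1 tx.2) ->
  (forall t x B, measurable B -> P (xi t x @^-1` B) = P (xi 0 0 @^-1` B)) ->
  (forall t x, 'E_P[xi t x] = 0)%E ->
  ('E_P[fun w => (xi 0 0 w ^+ 2)%R] < +oo)%E ->
  zsupp M p ->
  (forall c : R, -1 <= c <= 1 -> 0 < g.[c]) ->
  1 - charpoly2 p M = (1 - 'X) * g ->
  forall x, V0 P xi p x = fine 'V_P[xi 0 0] * (pi^-1 * ratfourier g 1 x).
Proof.
move=> mxi indep id mean0 var psupp g0 Qg x.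
have [C C0 hC] := ratfourier_charpoly2X_rate psupp g0 Qg 1.
have s0 : 0 <= fine 'V_P[xi 0 0] by rewrite fine_ge0// variance_ge0.
rewrite -ratfourier_even; apply: (@V0_lim _ _ _ _ _ mxi indep id mean0 var p M psupp
  (fine 'V_P[xi 0 0] * (pi^-1 * (2 * C)))); last exact: (cvg_sum_disc_corr psupp g0 Qg).
move=> J n Jn; rewrite -!mulrA ler_wpM2l//.
have -> : \sum_(4 ^ J <= k < n) disc_corr p k 0 =
    \sum_(k < n) disc_corr p k 0 - \sum_(k < 4 ^ J) disc_corr p k 0.
  rewrite -!(big_mkord xpredT (fun k => disc_corr p k 0)).
  by rewrite [in RHS](@big_cat_nat _ _ _ (4 ^ J) 0 n)//= addrAC subrr add0r.
(* The variance tail is a difference of two coefficients, of [Q] to the powers [4 ^ J] and [n], each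
   at most [C 2^-J] in absolute value; hence the constant [2 * C]. *)
rewrite !(sum_disc_corr psupp g0 Qg) -mulrBr ler_wpM2l ?invr_ge0 ?pi_ge0//.
have h1 := hC J n 0 Jn; have h2 := hC J _ 0 (leqnn (4 ^ J)%N).
rewrite !mul1r in h1 h2.
move: h1 h2; rewrite !ler_norml => /andP[h1 h1'] /andP[h2 h2'].
by lra.
Qed.

Theorem theorem2p6 (R : realType) (p : int -> R) (M : nat)
  (d : measure_display) (T : measurableType d) (P : probability T R)
  (xi : int -> int -> T -> R) :
  (forall x, 0 <= p x < 1) ->
  zsum p = 1 ->
  (forall x : int, (M%:Z < `|x|)%R -> p x = 0) ->
  strong_span1 p ->
  0 < pvar p ->
  (forall t x, measurable_fun setT (xi t x)) ->
  mutually_independent P (fun tx : int * int => xi tx.1 tx.2) ->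
  (forall t x B, measurable B -> P (xi t x @^-1` B) = P (xi 0 0 @^-1` B)) ->
  (forall t x, 'E_P[xi t x] = 0)%E ->
  ('E_P[fun w => (xi 0 0 w ^+ 2)%R] < +oo)%E ->
  let sxi2 := fine 'V_P[xi 0 0] in
  let V := V0 P xi p in
  (exists A c : R, 0 < A /\ 0 < c /\
     forall x : int, `|V x| <= A * expR (- c * `|(x%:~R : R)|)) /\
  (forall x : int, V x = sxi2 * (apot p (x - 1) + apot p (x + 1) - 2 * apot p x)) /\
  (forall x : int, ((V x)%:C =
     (sxi2 / pi)%:C *
       cintegral (fun theta => ((1 - cos theta)%:C / (1 - phiq p theta))
                               * expi (theta * x%:~R)) (- pi) pi)%C) /\
  cvgn (series (fun n : nat => `|V n%:Z| + `|V (- (n.+1)%:Z)|)) /\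
  series (fun n : nat => V n%:Z + V (- (n.+1)%:Z)) @ \oo --> sxi2 / pvar p.
Proof.
move=> p01 psum pM span pv mxi indep id mean0 var sxi2 V.
have p0 x : 0 <= p x by have /andP[] := p01 x.
have psupp := zsupp_of_norm pM.
have [g Qg g1] := charpoly2_factor psum psupp.
have g0 := charpoly2_factor_gt0 p0 psum psupp span pv Qg g1.
have VE x : V x = sxi2 * (pi^-1 * ratfourier g 1 x) by exact: V0_ratfourier Qg x.
have s0 : 0 <= sxi2 by rewrite fine_ge0// variance_ge0.
have sp0 : 0 <= sxi2 / pi by rewrite divr_ge0 ?pi_ge0.
have [A [c [A0 c0 hA]]] : exists A c : R, [/\ 0 < A, 0 < c &
    forall x, `|V x| <= A * expR (- c * `|x|%N%:R)].
  have [A [c [A0 c0 hA]]] := ratfourier_exp_decay g0 1.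
  (* The added 1 keeps the constant positive when the noise has variance zero. *)
  exists (sxi2 / pi * A + 1), c; split=> // [|x].
    by rewrite ltr_wpDl// mulr_ge0// ltW.
  rewrite VE mulrA normrM (ger0_norm sp0) mulrDl mul1r -[sxi2 / pi * A * _]mulrA.
  by rewrite ler_wpDr ?expR_ge0// ler_wpM2l.
split.
  exists A, c; split=> //; split=> // x.
  by rewrite -intr_norm -abszE -pmulrn.
split; first by move=> x; rewrite (apot_second_diff psupp g0 Qg).
split.
  move=> x; rewrite (cintegral_ratfourier psupp g0 Qg) VE mulrA.
  by rewrite -rmorphM.
split; first exact: exp_decay_cvg_series hA.
have lim : sxi2 / pi * series (fun n : nat => ratfourier g 1 n%:Z +
    ratfourier g 1 (- n.+1%:Z)) N @[N --> \oo] --> sxi2 / pi * (pi / pvar p).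
  by apply: cvgMl_tmp; exact: ratfourier_sum_cvg.
have -> : sxi2 / pvar p = sxi2 / pi * (pi / pvar p).
  by rewrite mulrA divfK// gt_eqF// pi_gt0.
rewrite (_ : series _ = fun N => sxi2 / pi * series (fun n : nat =>
  ratfourier g 1 n%:Z + ratfourier g 1 (- n.+1%:Z)) N)//.
apply/funext => N; rewrite /series/= mulr_sumr; apply: eq_bigr => n _.
by rewrite !VE mulrDr !mulrA.
Qed.
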